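(* Let $n\ge1$ and let $\mu$ be an unconditional log-concave measure on $\mathbb{R}^n$. Then for all non-empty ideals $A,B\subseteq\mathbb{R}^n$ and all $\lambda\in[0,1]$, $$\mu(\lambda A+(1-\lambda)B)^{1/n}\ \ge\ \lambda\,\mu(A)^{1/n}+(1-\lambda)\,\mu(B)^{1/n}.$$
   Context: A function $f$ on $\mathbb{R}^n$ is unconditional if $f(\varepsilon_1x_1,\ldots,\varepsilon_nx_n)=f(x)$ for all $x\in\mathbb{R}^n$ and all signs $\varepsilon_i\in\{-1,1\}$. A set $A\subseteq\mathbb{R}^n$ is an ideal if $(x_1,\ldots,x_n)\in A$ implies $(\delta_1x_1,\ldots,\delta_nx_n)\in A$ for all $\delta_1,\ldots,\delta_n\in[-1,1]$. An unconditional log-concave measure is a measure with a density $\varphi$ with respect to Lebesgue measure which is unconditional and log-concave, i.e. $\varphi=e^{-V}$ with $V:\mathbb{R}^n\to(-\infty,+\infty]$ convex and unconditional. (By a theorem of Borell, for measures with support not contained in a proper affine subspace, having a log-concave density is equivalent to $\mu(\lambda A+(1-\lambda)B)\ge\mu(A)^\lambda\mu(B)^{1-\lambda}$ for all non-empty compact $A,B$ and $\lambda\in[0,1]$.) The measure $\mu$ need not be finite; inequalities are understood in $[0,\infty]$ with $0\cdot\infty=0$. $\lambda A+(1-\lambda)B=\{\lambda a+(1-\lambda)b:a\in A,b\in B\}$. *)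

(* Defs.v *)
From HB Require Import structures.
From mathcomp Require Import all_boot all_order all_algebra.
From mathcomp Require Import all_classical all_reals all_analysis.
Set Implicit Arguments.
Unset Strict Implicit.
Unset Printing Implicit Defensive.
Import Order.TTheory GRing.Theory Num.Theory.
Import numFieldNormedType.Exports.
Local Open Scope classical_set_scope.
Local Open Scope ring_scope.

(* The product sigma-algebra on R^n, i.e. the one generated by the coordinate
   maps; this is the row-vector analogue of the library's instance on
   n.-tuple T. *)
Section measurable_row.
Context {R : realType} {n : nat}.

Definition row_coord (i : 'I_n) (x : 'rV[R]_n) : R := x ord0 i.

Let row_set0 : g_sigma_preimage row_coord set0.
Proof. exact: sigma_algebra0. Qed.

Let row_setC A : g_sigma_preimage row_coord A ->
  g_sigma_preimage row_coord (~` A).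
Proof. exact: sigma_algebraC. Qed.

Let row_bigcup (F : (set 'rV[R]_n)^nat) :
  (forall i, g_sigma_preimage row_coord (F i)) ->
  g_sigma_preimage row_coord (\bigcup_i (F i)).
Proof. exact: sigma_algebra_bigcup. Qed.

HB.instance Definition _ := @isMeasurable.Build
  (measure_tuple_display default_measure_display) 'rV[R]_n
  (g_sigma_preimage row_coord) row_set0 row_setC row_bigcup.

End measurable_row.

Lemma measurable_row_coord (R : realType) (n : nat) (i : 'I_n) :
  measurable_fun [set: 'rV[R]_n] (row_coord i).
Proof.
move=> _ Y mY; rewrite setTI; apply: sub_sigma_algebra => /=.
rewrite -bigcup_seq/=; exists i => /=; first by rewrite mem_index_enum.
by exists Y => //; rewrite setTI.
Qed.

Lemma measurable_fun_row_coordP d (T : measurableType d) (R : realType)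
    (n : nat) (f : T -> 'rV[R]_n) :
  (forall i, measurable_fun [set: T] (row_coord i \o f)) ->
  measurable_fun [set: T] f.
Proof.
move=> mf.
have mS : g_sigma_preimage (fun i => @row_coord R n i \o f) `<=` measurable.
  apply: smallest_sub; first exact: sigma_algebra_measurable.
  rewrite -bigcup_seq/= => A [i _ [B mB <-]].
  exact: mf.
move=> _ A mA; apply: mS.
by rewrite g_sigma_preimage_comp; exists A.
Qed.

Definition row_cons {R : realType} {n : nat} (p : measurableTypeR R * 'rV[R]_n)
    : 'rV[R]_n.+1 :=
  row_mx (const_mx p.1 : 'rV[R]_1) p.2.

Lemma row_cons0 (R : realType) (n : nat) (p : measurableTypeR R * 'rV[R]_n) :
  row_coord ord0 (row_cons p) = p.1.
Proof.
rewrite /row_coord /row_cons.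
have -> : (ord0 : 'I_n.+1) = lshift n (ord0 : 'I_1) by exact/val_inj.
apply: etrans (row_mxEl _ _ ord0 (ord0 : 'I_1)) _.
by rewrite mxE.
Qed.

Lemma row_consS (R : realType) (n : nat) (p : measurableTypeR R * 'rV[R]_n)
    (j : 'I_n) :
  row_coord (lift ord0 j) (row_cons p) = row_coord j p.2.
Proof.
rewrite /row_coord /row_cons.
have -> : (lift ord0 j : 'I_n.+1) = rshift 1 j by exact/val_inj.
exact: row_mxEr.
Qed.

Lemma measurable_row_cons (R : realType) (n : nat) :
  measurable_fun [set: measurableTypeR R * 'rV[R]_n] (@row_cons R n).
Proof.
apply: measurable_fun_row_coordP => i.
have [j ->|->] := unliftP ord0 i.
  rewrite (_ : _ \o _ = row_coord j \o snd); last first.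
    by apply/funext => p; exact: row_consS.
  exact: measurableT_comp (@measurable_row_coord R n j) measurable_snd.
rewrite (_ : _ \o _ = fst); last by apply/funext => p; exact: row_cons0.
exact: measurable_fst.
Qed.

Definition row_uncons {R : realType} {n : nat} (x : 'rV[R]_n.+1)
    : measurableTypeR R * 'rV[R]_n :=
  (row_coord ord0 x, \row_j row_coord (lift ord0 j) x).

Lemma row_consK (R : realType) (n : nat) :
  cancel (@row_cons R n) (@row_uncons R n).
Proof.
move=> [a v]; congr pair; first exact: row_cons0.
by apply/rowP => j; rewrite mxE row_consS.
Qed.

Lemma measurable_row_uncons (R : realType) (n : nat) :
  measurable_fun [set: 'rV[R]_n.+1] (@row_uncons R n).
Proof.
apply: measurable_fun_pair; first exact: measurable_row_coord.
apply: measurable_fun_row_coordP => i.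
rewrite (_ : _ \o _ = row_coord (lift ord0 i)); last first.
  by apply/funext => x; rewrite /= /row_coord mxE.
exact: measurable_row_coord.
Qed.

(* Lebesgue measure on the product sigma-algebra of R^n, as the n-fold product
   of the one-dimensional Lebesgue measure (R^0 being a point of mass 1). *)
Fixpoint borel_lebesgue (R : realType) (n : nat) : set 'rV[R]_n -> \bar R :=
  match n with
  | 0 => dirac (0 : 'rV[R]_0)
  | n'.+1 => pushforward (lebesgue_measure \x @borel_lebesgue R n')%E row_cons
  end.
Arguments borel_lebesgue : clear implicits.

Section sigma_finite_pack.
Context d (T : measurableType d) (R : realType).
Variable m : {measure set T -> \bar R}.
Hypothesis sm : sigma_finite setT m.

Definition sigma_finite_alias of sigma_finite setT m : set T -> \bar R := m.
HB.instance Definition _ := Measure.on (sigma_finite_alias sm).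
HB.instance Definition _ :=
  @Measure_isSigmaFinite.Build _ _ _ (sigma_finite_alias sm) sm.

Lemma sigma_finite_pack : exists m' : {sigma_finite_measure set T -> \bar R},
  m = m' :> (set T -> \bar R).
Proof. by exists (sigma_finite_alias sm). Qed.

End sigma_finite_pack.

(* The canonical sigma-finite structure on m1 \x m2 found by unification requires
   m1 and m2 to be subprobabilities, so sigma-finiteness is shown by hand. *)
Lemma sigma_finite_pushforward_prod d1 d2 d3 (T1 : measurableType d1)
    (T2 : measurableType d2) (T3 : measurableType d3) (R : realType)
    (m1 : {sigma_finite_measure set T1 -> \bar R})
    (m2 : {sigma_finite_measure set T2 -> \bar R})
    (f : T1 * T2 -> T3) (g : T3 -> T1 * T2) :
  measurable_fun [set: T1 * T2] f -> measurable_fun [set: T3] g ->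
  cancel f g ->
  exists m : {sigma_finite_measure set T3 -> \bar R},
    pushforward (m1 \x m2)%E f = m :> (set T3 -> \bar R).
Proof.
move=> mf mg fK.
pose p0 : {measure set T3 -> \bar R} :=
  measure_function_pushforward__canonical__measure_function_Measure
    (m1 \x m2)%E mf.
have sp0 : sigma_finite setT p0.
  have /sigma_finiteP[F [TF ndF Foo]] := sigma_finiteT m1.
  have /sigma_finiteP[G [TG ndG Goo]] := sigma_finiteT m2.
  exists (fun k => g @^-1` (F k `*` G k)).
    rewrite -preimage_bigcup -[LHS](preimage_setT g); congr (g @^-1` _).
    rewrite -setXTT TF TG predeqE => -[x y]; split.
      move=> [/= [i _ Fix] [k _ Gky]]; exists (maxn i k) => //; split.
      - by move: x Fix; exact/subsetPset/ndF/leq_maxl.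
      - by move: y Gky; exact/subsetPset/ndG/leq_maxr.
    by move=> [i _ []/= ? ?]; split; exists i.
  move=> k; have [mF Fk] := Foo k; have [mG Gk] := Goo k; split.
    by rewrite -[X in measurable X]setTI; apply: mg => //; exact: measurableX.
  rewrite (_ : p0 _ = (m1 \x m2)%E (F k `*` G k)).
    by rewrite product_measure1E// lte_mul_pinfty// ge0_fin_numE.
  congr ((m1 \x m2)%E _).
  by apply/funext => p; rewrite /preimage /= fK.
exact: (sigma_finite_pack sp0).
Qed.

Lemma borel_lebesgue_measure (R : realType) (n : nat) :
  exists m : {sigma_finite_measure set 'rV[R]_n -> \bar R},
    borel_lebesgue R n = m :> (set 'rV[R]_n -> \bar R).
Proof.
elim: n => [|n [m ih]].
  by exists [the {sigma_finite_measure set 'rV[R]_0 -> \bar R} of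
    dirac (0 : 'rV[R]_0)].
rewrite /= ih.
exact: (sigma_finite_pushforward_prod lebesgue_measure m
  (@measurable_row_cons R n) (@measurable_row_uncons R n) (@row_consK R n)).
Qed.

Section borel_lebesgue_instances.
Context {R : realType} (n : nat).
Let bl : set 'rV[R]_n -> \bar R := borel_lebesgue R n.

Let bl0 : borel_lebesgue R n (@set0 'rV[R]_n) = 0%E.
Proof. by have [m ->] := borel_lebesgue_measure R n. Qed.

Let bl_ge0 (A : set 'rV[R]_n) : (0 <= borel_lebesgue R n A)%E.
Proof. by have [m ->] := borel_lebesgue_measure R n. Qed.

Let bl_semi_sigma_additive : semi_sigma_additive bl.
Proof.
rewrite /bl; have [m ->] := borel_lebesgue_measure R n.
exact: measure_semi_sigma_additive.
Qed.

HB.instance Definition _ := isMeasure.Build _ _ _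
  (borel_lebesgue R n) bl0 bl_ge0 bl_semi_sigma_additive.

Let bl_sigma_finite : sigma_finite setT bl.
Proof.
rewrite /bl; have [m ->] := borel_lebesgue_measure R n.
exact: sigma_finiteT.
Qed.

HB.instance Definition _ := Measure_isSigmaFinite.Build _ _ _
  (borel_lebesgue R n) bl_sigma_finite.

End borel_lebesgue_instances.

(* R^n equipped with the sigma-algebra of its Lebesgue-measurable sets, i.e.
   the Caratheodory-measurable sets of the Lebesgue outer measure. Ideals (and
   convex functions) need not be Borel, but are Lebesgue measurable. *)
Definition lebesgueRn (R : realType) (n : nat) :=
  caratheodory_type (borel_lebesgue R n)^*%mu.
HB.instance Definition _ (R : realType) (n : nat) :=
  Measurable.on (lebesgueRn R n).

Definition lebesgue_measureRn {R : realType} {n : nat} :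
    set (lebesgueRn R n) -> \bar R :=
  @completed_measure_extension _ _ _ (borel_lebesgue R n).
HB.instance Definition _ (R : realType) (n : nat) :=
  Measure.on (@lebesgue_measureRn R n).

Definition unconditional {R : realType} {n : nat} {T : Type}
    (f : 'rV[R]_n -> T) :=
  forall (x : 'rV[R]_n) (eps : 'I_n -> R),
    (forall i, eps i = 1 \/ eps i = -1) ->
    f (\row_i (eps i * x ord0 i)) = f x.

Definition ideal {R : realType} {n : nat} (A : set 'rV[R]_n) :=
  forall (x : 'rV[R]_n) (delta : 'I_n -> R),
    A x -> (forall i, -1 <= delta i <= 1) ->
    A (\row_i (delta i * x ord0 i)).

(* Convexity for functions with values in (-oo, +oo]; the right-hand side uses
   the convention 0 * +oo = 0 at the endpoints. *)
Definition convex_ereal {R : realType} {n : nat} (V : 'rV[R]_n -> \bar R) :=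
  (forall x, V x != -oo%E) /\
  forall (x y : 'rV[R]_n) (t : R), 0 <= t <= 1 ->
    (V (t *: x + (1 - t) *: y)%R <= t%:E * V x + (1 - t)%:E * V y)%E.

(* mu has density exp(-V) with respect to Lebesgue measure, for some convex
   and unconditional V. The measurability of exp(-V) follows from convexity. *)
Definition unconditional_log_concave {R : realType} {n : nat}
    (mu : {measure set (lebesgueRn R n) -> \bar R}) :=
  exists V : 'rV[R]_n -> \bar R,
    [/\ convex_ereal V, unconditional V &
      forall A : set (lebesgueRn R n), measurable A ->
        mu A = (\int[lebesgue_measureRn]_(x in A) expeR (- V x))%E].

(* Main.v *)
Require Import Defs.
From HB Require Import structures.
From mathcomp Require Import all_boot all_order all_algebra.
From mathcomp Require Import all_classical all_reals all_analysis.
From mathcomp Require Import measurable_realfun.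
From mathcomp Require Import ring lra.
Import Order.TTheory GRing.Theory Num.Theory.
Import numFieldNormedType.Exports.
Local Open Scope classical_set_scope.
Local Open Scope ring_scope.
Set Implicit Arguments.
Unset Strict Implicit.
Unset Printing Implicit Defensive.

(** Let [mu] have density [phi = exp (- V)], and let [C] be the combination
    [lambda A + (1 - lambda) B]. The idea is to combine points of [A] and [B] by
    geometric rather than arithmetic means of their coordinates, with a weight
    [p] other than [lambda]. For [0 < p < 1] put
    [c = (lambda / p)^p ((1 - lambda) / (1 - p))^(1 - p)]. If [x] is in [A], [y]
    is in [B], and [z] has coordinates [z_i = c |x_i|^p |y_i|^(1 - p)], the
    inequality between weighted means gives two bounds:
    - [z_i <= lambda |x_i| + (1 - lambda) |y_i|], so [z] belongs to [C] because
      [C] is an ideal;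
    - [c <= 1], so [z_i <= p |x_i| + (1 - p) |y_i|]; as [V] is convex and
      unconditional it increases with each [|x_i|], hence
      [phi z >= phi x ^ p * phi y ^ (1 - p)].
    In logarithmic coordinates [(x, y) |-> (|x_i|^p |y_i|^(1 - p))_i] is a convex
    combination and Lebesgue measure has a log-linear density, so the
    Prekopa-Leindler inequality yields
    [mu C >= c^n (mu A)^p (mu B)^(1 - p)] for every [p]. With
    [a = mu A ^ (1 / n)], [b = mu B ^ (1 / n)] and
    [p = lambda a / (lambda a + (1 - lambda) b)], the right-hand side is exactly
    [(lambda a + (1 - lambda) b)^n] ([optimal_exponent]). When [mu A] or [mu B]
    vanishes one uses [mu C >= lambda^n mu A] and its symmetric counterpart,
    which hold as [C] contains [lambda A] and [phi (lambda x) >= phi x].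

    The Prekopa-Leindler inequality is proved on the line from the
    Brunn-Minkowski inequality for superlevel sets ([prekopa_leindler_line]),
    transported to multiplicative form by the substitution [x = +- exp t]
    ([prekopa_leindler_mul_line]), and extended to all dimensions by integrating
    over fibres ([prekopa_leindler_mul]).

    This argument needs Borel functions, whereas ideals, and [phi], are only
    Lebesgue measurable. The Borel function [inner_fun f], built from the values
    of [f] at rational points, satisfies
    [inner_fun f x <= f x <= inner_fun f (t x)] for all [t < 1] as soon as [f]
    decreases with each [|x_i|]. Because dilations scale the integral
    continuously, [f] and [inner_fun f] have the same integral
    ([integral_solid]); the same sandwich shows that ideals are measurable
    ([solid_set_measurable]). *)

(** * Weighted geometric means *)

Section geometric_means.
Context (R : realType) (p : R).
Hypothesis p01 : 0 < p < 1.

Let p0 : 0 < p. Proof. by case/andP: p01. Qed.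
Let q0 : 0 < 1 - p. Proof. by case/andP: p01 => _; rewrite subr_gt0. Qed.

Lemma powR_amgm (x y : R) : 0 <= x -> 0 <= y ->
  x `^ p * y `^ (1 - p) <= p * x + (1 - p) * y.
Proof.
move=> x0 y0.
have := @conjugate_powR R (x `^ p) (y `^ (1 - p)) p^-1 (1 - p)^-1
  (powR_ge0 _ _) (powR_ge0 _ _).
rewrite !invr_gt0 !invrK => /(_ p0 q0); rewrite addrC subrK => /(_ erefl).
by rewrite -!powRrM !divff ?gt_eqF// !powRr1// (mulrC x) (mulrC y).
Qed.

Lemma powR_geo (a : R) : 0 <= a -> a `^ p * a `^ (1 - p) = a.
Proof.
have pq : p + (1 - p) = 1 by rewrite addrC subrK.
by move=> a0; rewrite -powRD pq ?oner_eq0// powRr1.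
Qed.

Local Open Scope ereal_scope.

Lemma poweR_amgm (x y : \bar R) : 0 <= x -> 0 <= y ->
  x `^ p * y `^ (1 - p) <= p%:E * x + (1 - p)%:E * y.
Proof.
have pE : 0 < p%:E by rewrite lte_fin.
have qE : 0 < (1 - p)%:E by rewrite lte_fin.
case: x => [x||]// x0; case: y => [y||]// y0.
- by rewrite !poweR_EFin -!EFinM -EFinD lee_fin powR_amgm.
- by rewrite (gt0_muley qE) addey// leey.
- by rewrite (gt0_muley pE) addye// leey.
- by rewrite (gt0_muley pE) (gt0_muley qE) leey.
Qed.

Lemma le_poweR (x y : \bar R) (r : R) : (0 <= r)%R -> 0 <= x -> x <= y ->
  x `^ r <= y `^ r.
Proof.
move=> r0 x0 xy; apply: gt0_ler_poweR => //; rewrite in_itv/= leey andbT//.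
exact: le_trans xy.
Qed.

Lemma lee_poweR_geo (a b u v : \bar R) : 0 <= a -> 0 <= b -> a <= u -> b <= v ->
  a `^ p * b `^ (1 - p) <= u `^ p * v `^ (1 - p).
Proof.
move=> a0 b0 au bv.
by apply: lee_pmul; rewrite ?poweR_ge0//; apply: le_poweR => //; exact: ltW.
Qed.

Lemma lt_poweR_geo (s : R) (u v : \bar R) : (0 <= s)%R ->
  s%:E < u -> s%:E < v -> s%:E < u `^ p * v `^ (1 - p).
Proof.
move=> s0.
have pow r (w : \bar R) : (0 < r)%R -> s%:E < w -> (s `^ r)%:E < w `^ r.
  move=> r0; case: w => [w||]//; last by move=> _; rewrite poweRyr ?gt_eqF// ltry.
  rewrite poweR_EFin !lte_fin => sw.
  by apply: gt0_ltr_powR => //; rewrite nnegrE// (le_trans s0)// ltW.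
move=> su sv; rewrite -[in ltLHS](powR_geo s0) EFinM.
by apply: lte_pmul; rewrite ?lee_fin ?powR_ge0//; exact: pow.
Qed.

Lemma poweR_geoM (a b : R) (u v : \bar R) : (0 <= a)%R -> (0 <= b)%R ->
  0 <= u -> 0 <= v ->
  (a%:E * u) `^ p * (b%:E * v) `^ (1 - p) =
  (a `^ p * b `^ (1 - p))%:E * (u `^ p * v `^ (1 - p)).
Proof. by move=> a0 b0 u0 v0; rewrite !poweRM ?lee_fin// muleACA EFinM. Qed.

End geometric_means.

Lemma expR_powR (R : realType) (s p : R) : expR s `^ p = expR (p * s).
Proof. by rewrite /powR gt_eqF ?expR_gt0// expRK. Qed.

Section limit_of_powers.
Local Open Scope ereal_scope.

(** If [K] is finite and [c] positive, the hypothesis bounds [u k], and a bound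
    on a sequence passes to its limit; this avoids continuity of the power
    function at [+oo]. *)
Lemma poweR_mul_cvg_le (R : realType) (p : R) (u : (\bar R)^nat) (l c K : \bar R) :
  (0 < p)%R -> (forall k, 0 <= u k) -> 0 <= c -> u @ \oo --> l ->
  (forall k, u k `^ p * c <= K) -> l `^ p * c <= K.
Proof.
move=> p0 u0 c0 ul uK.
have pN0 : p != 0%R by rewrite gt_eqF.
have K0 : 0 <= K by apply: le_trans (uK 0%N); rewrite mule_ge0 ?poweR_ge0.
have l0 : 0 <= l by apply: cvge_to_ge ul _; exact: nearW.
have [->|Koo] := eqVneq K +oo; first by rewrite leey.
have [->|cN0] := eqVneq c 0; first by rewrite mule0.
have cp : 0 < c by rewrite lt_neqAle eq_sym cN0.
have Kfin : K \is a fin_num by rewrite ge0_fin_numE// ltey.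
have [coo|cfin] := eqVneq c +oo.
  have uz k : u k = 0.
    apply/eqP; rewrite eq_le u0 andbT leNgt; apply/negP => uk.
    have := uK k; rewrite coo gt0_muley ?poweR_gt0// leye_eq => /eqP Ky.
    by rewrite Ky eqxx in Koo.
  have -> : l = 0.
    apply/eqP; rewrite eq_le l0 andbT; apply: cvge_to_le ul _.
    by apply: nearW => k; rewrite uz.
  by rewrite poweR0r// mul0e.
have {}cfin : c \is a fin_num by rewrite ge0_fin_numE// ltey.
move: c K c0 cp cfin K0 Kfin uK {cN0 Koo} => [c||]// [K||]// _ c0 _ K0 _ uK.
rewrite lte_fin in c0; rewrite lee_fin in K0.
have Kc0 : (0 <= K / c)%R by rewrite divr_ge0// ltW.
have lL : l <= ((K / c) `^ p^-1)%:E.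
  apply: cvge_to_le ul _; apply: nearW => k.
  have := uK k; rewrite -lee_pdivlMr// => ukp.
  have ip0 : (0 <= p^-1)%R by rewrite invr_ge0 ltW.
  have := le_poweR ip0 (poweR_ge0 _ _) ukp.
  by rewrite -poweRrM divff// poweRe1.
rewrite -lee_pdivlMr//.
by have := le_poweR (ltW p0) l0 lL; rewrite poweR_EFin -powRrM mulVf// powRr1.
Qed.

End limit_of_powers.

(** * Layer cake *)

Section layer_cake.
Context d (T : measurableType d) (R : realType).
Variable m : {sigma_finite_measure set T -> \bar R}.
Notation leb := (@lebesgue_measure R).
Local Open Scope ereal_scope.

Definition undergraph (F : T -> \bar R) : set (T * measurableTypeR R) :=
  [set z | 0 <= z.2%:E /\ z.2%:E < F z.1].

Lemma measurable_undergraph (F : T -> \bar R) : measurable_fun [set: T] F ->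
  measurable (undergraph F).
Proof.
move=> mF.
have m2 : measurable_fun [set: T * measurableTypeR R] (fun z => z.2%:E).
  by apply/measurable_EFinP => /=; exact: measurable_snd.
rewrite (_ : undergraph F = ([set: T * measurableTypeR R] `&` [set z | 0 <= z.2%:E]) `&`
  ([set: T * measurableTypeR R] `&` [set z | z.2%:E < F z.1])).
  apply: measurableI; first exact: (emeasurable_fun_c_infty measurableT m2 0).
  by apply: measurable_lte => //; exact: measurableT_comp.
by rewrite !setTI.
Qed.

Lemma ysection_undergraph (F : T -> \bar R) s :
  ysection (undergraph F) s = [set x | 0 <= s%:E /\ s%:E < F x].
Proof. by apply/seteqP; split => x; rewrite /ysection/= inE. Qed.

Lemma measurable_level (F : T -> \bar R) (s : R) : measurable_fun [set: T] F ->
  measurable [set x | 0 <= s%:E /\ s%:E < F x].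
Proof.
move=> mF; rewrite -ysection_undergraph.
by apply: measurable_ysection; exact: measurable_undergraph mF.
Qed.

Lemma lebesgue_measure_levels (y : \bar R) : 0 <= y ->
  leb [set s | 0 <= s%:E /\ s%:E < y] = y.
Proof.
case: y => [y||]//= y0.
  rewrite (_ : [set _ | _] = `[0%R, y[%classic); last first.
    by apply/seteqP; split=> s /=; rewrite in_itv/= lee_fin lte_fin => /andP.
  rewrite lebesgue_measure_itv/= lte_fin; case: ltP => //.
    by rewrite sube0.
  by move=> yl; congr (_%:E); apply/eqP; rewrite eq_le yl -lee_fin y0.
rewrite (_ : [set _ | _] = `[0%R, +oo[%classic); last first.
  apply/seteqP; split=> s /=; rewrite in_itv/= lee_fin ltry.
    by case=> ->.
  by rewrite andbT.
by rewrite lebesgue_measure_itv/= ltry.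
Qed.

(** Tonelli on the region under the graph of [F]. The weight [w] serves to
    integrate against a density known only through the measures of sets. *)
Lemma weighted_layer_cake (F w : T -> \bar R) : measurable_fun [set: T] F ->
  measurable_fun [set: T] w -> (forall x, 0 <= F x) -> (forall x, 0 <= w x) ->
  \int[m]_x (w x * F x) =
  \int[leb]_s \int[m]_x (w x * (\1_(undergraph F) (x, s))%:E).
Proof.
move=> mF mw F0 w0.
pose h (z : T * measurableTypeR R) := w z.1 * (\1_(undergraph F) z)%:E.
have mU := measurable_undergraph mF.
have mh : measurable_fun setT h.
  apply: emeasurable_funM; first exact: measurableT_comp.
  exact/measurable_EFinP/measurable_indic.
have h0 z : 0 <= h z by rewrite mule_ge0// lee_fin.
transitivity (\int[m]_x \int[leb]_s h (x, s)); last first.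
  exact: (fubini_tonelli (m1 := m) (m2 := leb) h mh h0).
have m1 x : measurable_fun [set: measurableTypeR R]
    (fun s => (\1_(undergraph F) (x, s))%:E : \bar R).
  apply/measurable_EFinP.
  rewrite (_ : (fun _ => _) = \1_(xsection (undergraph F) x)).
    exact/measurable_indic/measurable_xsection.
  by apply/funext => s; rewrite !indicE /xsection/= mem_setE.
apply: eq_integral => x _; rewrite /h/=.
rewrite (ge0_integralZl leb measurableT (m1 x))//.
congr (_ * _); rewrite -[LHS](lebesgue_measure_levels (F0 x)).
rewrite (_ : [set _ | _] = xsection (undergraph F) x); last first.
  by apply/seteqP; split => s; rewrite /xsection/= inE.
rewrite -[X in leb X]setIT -integral_indic//; last exact: measurable_xsection.
by apply: eq_integral => s _; rewrite !indicE /xsection/= mem_setE.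
Qed.

Lemma layer_cake (F : T -> \bar R) : measurable_fun [set: T] F -> (forall x, 0 <= F x) ->
  \int[m]_x F x = \int[leb]_s m [set x | 0 <= s%:E /\ s%:E < F x].
Proof.
move=> mF F0; have := @weighted_layer_cake F (cst 1) mF (measurable_cst _) F0.
rewrite (eq_integral F) => [->//|x _]; last by rewrite mul1e.
apply: eq_integral => s _; under eq_integral do rewrite mul1e.
by rewrite -[X in m X]setIT -integral_indic//; exact: measurable_level.
Qed.

Lemma measurable_level_measure (F : T -> \bar R) : measurable_fun [set: T] F ->
  measurable_fun [set: measurableTypeR R]
    (fun s => m [set x | 0 <= s%:E /\ s%:E < F x]).
Proof.
move=> mF; have := measurable_fun_ysection m (measurable_undergraph mF).
by congr (measurable_fun _ _); apply/funext => s /=; rewrite ysection_undergraph.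
Qed.

End layer_cake.

(** * Changes of variables on the line *)

Section lebesgue_affine.
Context (R : realType) (a b : R).
Hypothesis a0 : (0 < a)%R.
Notation leb := (@lebesgue_measure R).
Local Open Scope ereal_scope.
Let T (x : measurableTypeR R) : measurableTypeR R := (a * x + b)%R.

Let mT : measurable_fun [set: measurableTypeR R] T.
Proof. by apply: measurable_funD => //; exact: measurable_funM. Qed.

Lemma lebesgue_measure_affine (X : set (measurableTypeR R)) : measurable X ->
  leb X = a%:E * leb [set x | X (a * x + b)%R].
Proof.
pose nu := mscale (NngNum (ltW a0))
  (measure_function_pushforward__canonical__measure_function_Measure leb mT).
move=> mX; rewrite -[RHS]/(nu X).
apply: lebesgue_measure_unique => // _ [[u v] _ <-] /=.
rewrite /nu /mscale/= /pushforward.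
rewrite (_ : T @^-1` _ = `]((u - b) / a)%R, ((v - b) / a)%R]%classic); last first.
  apply/seteqP; split=> x /=; rewrite /T !in_itv/=;
  by rewrite ltr_pdivrMr// ler_pdivlMr// ltrBlDr lerBrDr (mulrC x).
rewrite !lebesgue_measure_itv/= !lte_fin ltr_pM2r ?invr_gt0// ltrD2r.
case: ifPn => _; last by rewrite mule0.
by rewrite -!EFinB -EFinM; congr (_%:E); field; rewrite gt_eqF.
Qed.

Lemma ge0_integral_affine (f : measurableTypeR R -> \bar R) :
  measurable_fun [set: measurableTypeR R] f -> (forall x, 0 <= f x) ->
  \int[leb]_x f x = a%:E * \int[leb]_x f (a * x + b)%R.
Proof.
move=> mf f0.
have := ge0_integral_pushforward mT leb measurableT mf (fun x _ => f0 x).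
rewrite preimage_setT => /= <-.
pose nu := measure_function_pushforward__canonical__measure_function_Measure leb mT.
have /= <- := @ge0_integral_mscale _ _ R nu _ measurableT (NngNum (ltW a0)) _ mf
  (fun x _ => f0 x).
by apply: eq_measure_integral => X mX _; exact: lebesgue_measure_affine.
Qed.

End lebesgue_affine.

Section exp_substitution.
Context (R : realType).
Notation leb := (@lebesgue_measure R).
Local Open Scope ereal_scope.

Let expR_nd : nondecreasing (@expR R).
Proof. by move=> x y; rewrite ler_expR. Qed.

Let expR_rc : right_continuous (@expR R).
Proof. by apply/right_continuousW => x; exact: continuous_expR. Qed.

HB.instance Definition _ := isCumulative.Build R _ R (@expR R) expR_nd expR_rc.

(** The image by [ln] of Lebesgue measure on the positive half-line, given here
    by its density ([lnE]). *)
Definition exp_measure (A : set (measurableTypeR R)) : \bar R :=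
  \int[leb]_(t in A) (expR t)%:E.

Let mexp : measurable_fun [set: measurableTypeR R] (fun t => (expR t)%:E : \bar R).
Proof. by apply/measurable_EFinP; exact: measurable_expR. Qed.

Let exp_measure0 : exp_measure set0 = 0.
Proof. exact: integral_set0. Qed.

Let exp_measure_ge0 A : 0 <= exp_measure A.
Proof. by apply: integral_ge0 => t _; rewrite lee_fin expR_ge0. Qed.

Let exp_measure_sigma : semi_sigma_additive exp_measure.
Proof.
apply: (semi_sigma_additive_nng_induced mexp) => t.
by rewrite lee_fin expR_ge0.
Qed.

HB.instance Definition _ := isMeasure.Build _ _ _ exp_measure
  exp_measure0 exp_measure_ge0 exp_measure_sigma.

Let LS_itv (a b : R) : (a < b)%R ->
  lebesgue_stieltjes_measure (@expR R) `]a, b]%classic = (expR b - expR a)%:E.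
Proof.
move=> ab; rewrite /lebesgue_stieltjes_measure /measure_extension.
rewrite measurable_mu_extE/=; last exact: is_ocitv.
by rewrite wlength_itv_bnd ?ltW.
Qed.

(* Both descriptions of this measure give [expR b - expR a] to ]a, b], which
   characterises the Stieltjes measure of the exponential. *)
Let exp_measureE (A : set (measurableTypeR R)) : measurable A ->
  exp_measure A = lebesgue_stieltjes_measure (@expR R) A.
Proof.
move=> mA; apply/esym/lebesgue_stieltjes_measure_unique => // X.
move=> /ocitvP[->|[[a b] /= ab ->]].
  by rewrite !measure0.
rewrite LS_itv// /exp_measure integral_itv_obnd_cbnd; last first.
  exact: measurable_funTS.
rewrite (continuous_FTC2 (F := @expR R))//.
- exact/continuous_subspaceT/continuous_expR.
- by split => //; exact: cvg_at_left_filter (@continuous_expR R b).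
- by move=> x _; rewrite derive1E derive_val.
Qed.

Let halfline : set (measurableTypeR R) := `]0%R, +oo[%classic.
Let mhalf : measurable halfline. Proof. exact: measurable_itv. Qed.

Let lnE (A : set (measurableTypeR R)) : measurable A ->
  leb (@ln R @^-1` A `&` halfline) = exp_measure A.
Proof.
move=> mA; rewrite exp_measureE//.
pose lnR (x : measurableTypeR R) : measurableTypeR R := ln x.
have mln : measurable_fun [set: measurableTypeR R] lnR by exact: measurable_ln.
pose nu := measure_function_pushforward__canonical__measure_function_Measure
  (mrestr leb mhalf) mln.
rewrite -[LHS]/(nu A); apply/esym.
apply: (@lebesgue_stieltjes_measure_unique R (@expR R) nu _ A mA) => X.
move=> /ocitvP[->|[[a b] /= ab ->]].
  by rewrite !measure0.
rewrite LS_itv// /pushforward /mrestr.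
rewrite (_ : _ `&` _ = `](expR a), (expR b)]%classic).
  by rewrite lebesgue_measure_itv/= lte_fin ltr_expR ab.
apply/seteqP; split=> x /=; rewrite /halfline/= !in_itv/= andbT.
  move=> [/andP[ax xb] x0].
  by rewrite -(@lnK _ x)// ltr_expR ler_expR ax.
move=> /andP[ax xb]; have x0 : (0 < x)%R by rewrite (lt_trans _ ax)// expR_gt0.
by split=> //; rewrite -ltr_expR -ler_expR lnK// ax.
Qed.

Lemma ge0_integral_halfline_exp (f : measurableTypeR R -> \bar R) :
  measurable_fun [set: measurableTypeR R] f -> (forall x, 0 <= f x) ->
  \int[leb]_(x in `]0%R, +oo[) f x = \int[leb]_t ((expR t)%:E * f (expR t)).
Proof.
move=> mf f0.
pose expT (t : measurableTypeR R) : measurableTypeR R := expR t.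
have mexpT : measurable_fun [set: measurableTypeR R] expT.
  exact: measurable_expR.
have mF : measurable_fun [set: measurableTypeR R] (f \o expT).
  exact: measurableT_comp.
have g0 x : 0 <= (f \_ halfline) x by apply: erestrict_ge0.
have mg : measurable_fun [set: measurableTypeR R] (f \_ halfline).
  by have := (measurable_restrictT f mhalf).1; apply; exact: measurable_funTS.
rewrite integral_mkcond -/halfline (layer_cake leb mg g0).
rewrite (@weighted_layer_cake _ _ _ leb (f \o expT) (EFin \o @expR R))//; last 2 first.
- by move=> x; exact: f0.
- by move=> x; rewrite lee_fin expR_ge0.
apply: eq_integral => s _.
pose L := [set t : measurableTypeR R | 0 <= s%:E /\ s%:E < f (expR t)].
have mL : measurable L by exact: (measurable_level s mF).
transitivity (leb (@ln R @^-1` L `&` halfline)).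
  congr (leb _); apply/seteqP; split=> x /=.
    move=> [s0]; rewrite patchE; case: ifPn => [|_]; last by rewrite ltNge s0.
    rewrite inE => xh sx; split => //; split=> //.
    by move: xh; rewrite /halfline/= in_itv/= andbT => xh; rewrite lnK.
  move=> [[s0 sx] xh]; rewrite patchE mem_set//; split => //.
  by move: xh sx; rewrite /halfline/= in_itv/= andbT => xh; rewrite lnK.
rewrite lnE// /exp_measure integral_mkcond; apply: eq_integral => t _.
rewrite patchE indicE; case: ifPn => [|].
  by rewrite inE => Lt; rewrite mem_set// mule1.
by rewrite notin_setE => Lt; rewrite memNset ?mule0.
Qed.

(** Both half-lines are parametrised by the exponential, which turns
    multiplicative inequalities on the line into additive ones. *)
Lemma ge0_integral_exp (f : measurableTypeR R -> \bar R) :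
  measurable_fun [set: measurableTypeR R] f -> (forall x, 0 <= f x) ->
  \int[leb]_x f x =
  \int[leb]_t ((expR t)%:E * (f (expR t) + f (- expR t)%R)).
Proof.
move=> mf f0.
pose g (x : measurableTypeR R) := f (- x)%R.
have mg : measurable_fun [set: measurableTypeR R] g.
  by apply: (measurableT_comp mf); exact: oppr_measurable.
have mexpT : measurable_fun [set: measurableTypeR R] (@expR R : measurableTypeR R -> measurableTypeR R).
  exact: measurable_expR.
have negE : \int[leb]_(x in `]-oo, 0%R]) f x = \int[leb]_(x in `]0%R, +oo[) g x.
  rewrite integral_itv_obnd_cbnd; last exact: measurable_funTS.
  rewrite ge0_integration_by_substitution0//; last by move=> r; exact: f0.
  by apply: eq_integral => x _; rewrite /g opprK.
rewrite -[in LHS]set_itvNyy (@itv_bndbnd_setU _ _ _ (BRight 0%R))//.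
rewrite ge0_integral_setU//; last 2 first.
- exact: measurable_funTS.
- apply/disj_setPS => x [] /=; rewrite !in_itv/= andbT => /le_lt_trans /[apply].
  by rewrite ltxx.
rewrite negE !ge0_integral_halfline_exp//; last by move=> x; exact: f0.
rewrite -ge0_integralD//; last 4 first.
- by move=> t _; rewrite mule_ge0 ?lee_fin ?expR_ge0//; exact: f0.
- by apply: emeasurable_funM => //; exact: measurableT_comp.
- by move=> t _; rewrite mule_ge0// lee_fin expR_ge0.
- by apply: emeasurable_funM => //; exact: measurableT_comp.
by apply: eq_integral => t _; rewrite ge0_muleDr//; exact: addeC.
Qed.

End exp_substitution.

(** * The Brunn-Minkowski inequality on the line *)

Section brunn_minkowski_line.
Context (R : realType).
Notation leb := (@lebesgue_measure R).
Implicit Types X Y W : set (measurableTypeR R).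

(** The sequence consists of the integers if [X] is unbounded, and otherwise
    approaches [sup X], which does not belong to [X]. *)
Lemma cofinal_seq (X : set R) : X !=set0 ->
  (forall x, X x -> exists2 y, X y & x < y) ->
  exists c : R^nat, [/\ nondecreasing_seq c,
    forall k, exists2 y, X y & c k < y & forall x, X x -> exists k, x < c k].
Proof.
move=> X0 Xmax; have [ubX|nubX] := pselect (has_ubound X); last first.
  exists (fun k => k%:R); split.
  - by move=> m n mn; rewrite ler_nat.
  - move=> k; have [//|Xk] := pselect (exists2 y, X y & k%:R < y).
    exfalso; apply: nubX; exists k%:R => y Xy; rewrite leNgt; apply/negP => ky.
    by apply: Xk; exists y.
  - move=> x _; exists (Num.truncn `|x|).+1.
    by rewrite (le_lt_trans (ler_norm x))// truncnS_gt.
exists (fun k => sup X - k.+1%:R^-1); split.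
- by move=> m n mn; rewrite lerD2l lerN2 lef_pV2 ?posrE ?ltr0n// ler_nat.
- by move=> k; apply: sup_adherent; rewrite ?invr_gt0 ?ltr0n.
- move=> x Xx; have [y Xy xy] := Xmax _ Xx.
  have xs : x < sup X by rewrite (lt_le_trans xy)// sup_upper_bound.
  by have [k xk] := ltr_add_invr xs; exists k; rewrite ltrBrDr.
Qed.

Local Open Scope ereal_scope.

(** A bound on the segments of [X] cut at its own points bounds [X]: they
    exhaust [X], up to its maximum if there is one. The affine form of the bound
    lets this apply to two sets in turn. *)
Lemma lebesgue_measure_initial X (a : R) (b K : \bar R) :
  measurable X -> X !=set0 -> 0 <= b -> (0 <= a)%R ->
  (forall x, X x -> a%:E * leb (X `&` `]-oo, x[%classic) + b <= K) ->
  a%:E * leb X + b <= K.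
Proof.
move=> mX X0 b0 a0 XK.
have mi x : measurable (X `&` `]-oo, x[%classic).
  by apply: measurableI => //; exact: measurable_itv.
have [[x Xx xmax]|nmax] := pselect (exists2 x, X x & forall y, X y -> (y <= x)%R).
  rewrite (_ : leb X = leb (X `&` `]-oo, x[%classic)); first exact: XK.
  apply/eqP; rewrite eq_le; apply/andP; split; last first.
    by rewrite le_measure ?inE.
  apply: (@le_trans _ _ (leb (X `&` `]-oo, x[%classic `|` [set x]))).
    rewrite le_measure ?inE//; first exact: measurableU.
    move=> y Xy; have := xmax _ Xy; rewrite le_eqVlt => /orP[/eqP ->|xy].
      by right.
    by left; split => //=; rewrite in_itv.
  rewrite (le_trans (measureU2 _ _ _))//.
  by rewrite [X in _ + X]lebesgue_measure_set1 adde0.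
have [||c [ndc cX Xc]] := @cofinal_seq X; first exact: X0.
  move=> x Xx; apply: contrapT => nx; apply: nmax; exists x => // y Xy.
  by rewrite leNgt; apply/negP => xy; apply: nx; exists y.
pose F k := X `&` `]-oo, c k[%classic.
have bigF : \bigcup_k F k = X.
  apply/seteqP; split=> x; first by move=> [k _ []].
  by move=> Xx; have [k xk] := Xc _ Xx; exists k => //; split => //=; rewrite in_itv.
have cF : leb \o F @ \oo --> leb X.
  rewrite -[in leb X]bigF; apply: nondecreasing_cvg_mu => //.
  - by move=> k; exact: mi.
  - by rewrite bigF.
  - move=> m n mn; apply/subsetPset => x [Xx] /=; rewrite !in_itv/= => xm.
    by split=> //=; rewrite in_itv/= (lt_le_trans xm)// ndc.
have cG : (fun k => a%:E * (leb \o F) k + b) @ \oo --> a%:E * leb X + b.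
  apply: cvgeD; last exact: cvg_cst.
    by rewrite ge0_adde_def// inE// mule_ge0// lee_fin.
  exact: cvgeZl.
apply: cvge_to_le cG _; apply: nearW => k.
have [y Xy cy] := cX k; apply: le_trans (XK _ Xy).
rewrite leeD2r// lee_wpmul2l ?lee_fin//= le_measure ?inE//; first exact: mi.
move=> x [Xx] /=.
by rewrite !in_itv/= => xc; split => //; exact: lt_trans cy.
Qed.

Lemma lebesgue_measure_final X (a : R) (b K : \bar R) :
  measurable X -> X !=set0 -> 0 <= b -> (0 <= a)%R ->
  (forall x, X x -> a%:E * leb (X `&` `]x, +oo[%classic) + b <= K) ->
  a%:E * leb X + b <= K.
Proof.
move=> mX [x0 Xx0] b0 a0 XK.
have mopp : measurable_fun [set: measurableTypeR R] (-%R : _ -> measurableTypeR R).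
  exact: oppr_measurable.
have mN Y : measurable Y -> measurable (-%R @^-1` Y : set (measurableTypeR R)).
  by move=> mY; rewrite -[X in measurable X]setTI; exact: mopp.
rewrite -lebesgue_measureN//; apply: lebesgue_measure_initial => //.
- exact: mN.
- by exists (- x0)%R; rewrite /preimage/= opprK.
- move=> x Xx; have := XK _ Xx; apply: le_trans; rewrite leeD2r//.
  rewrite lee_wpmul2l ?lee_fin// -[leRHS]lebesgue_measureN; last first.
    by apply: measurableI => //; exact: measurable_itv.
  rewrite /pushforward le_measure ?inE//.
  - by apply: measurableI; [exact: mN|exact: measurable_itv].
  - by apply: mN; apply: measurableI => //; exact: measurable_itv.
  - by move=> y [Xy] /=; rewrite !in_itv/= andbT ltrN2.
Qed.

(** For [x] in [X] and [y] in [Y], the set [W] contains the part of [X] below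
    [x], scaled by [p] and translated by [(1 - p) * y], and the part of [Y] above
    [y], scaled by [1 - p] and translated by [p * x]. These lie on either side of
    [p * x + (1 - p) * y], so their measures add up. *)
Lemma brunn_minkowski_line X Y W (p : R) : (0 < p < 1)%R ->
  measurable X -> measurable Y -> measurable W -> X !=set0 -> Y !=set0 ->
  (forall x y, X x -> Y y -> W (p * x + (1 - p) * y)%R) ->
  p%:E * leb X + (1 - p)%:E * leb Y <= leb W.
Proof.
move=> /andP[p0 p1] mX mY mW X0 Y0 XYW.
have q0 : (0 < 1 - p)%R by rewrite subr_gt0.
have pE : 0 <= p%:E by rewrite lee_fin ltW.
have qE : 0 <= (1 - p)%:E by rewrite lee_fin ltW.
apply: lebesgue_measure_initial => //; first exact: mule_ge0.
move=> x Xx; rewrite addeC.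
apply: lebesgue_measure_final => //; first exact: mule_ge0.
move=> y Yy; rewrite addeC.
pose z := (p * x + (1 - p) * y)%R.
have mWl : measurable (W `&` `]-oo, z[%classic).
  by apply: measurableI => //; exact: measurable_itv.
have mWr : measurable (W `&` `]z, +oo[%classic).
  by apply: measurableI => //; exact: measurable_itv.
have maff (a b : R) V : measurable V -> measurable [set t : measurableTypeR R | V (a * t + b)%R].
  move=> mV; rewrite -[X in measurable X]setTI.
  have mT : measurable_fun [set: measurableTypeR R] (fun t => a * t + b : measurableTypeR R)%R.
    by apply: measurable_funD => //; exact: measurable_funM.
  exact: mT.
apply: (@le_trans _ _ (leb (W `&` `]-oo, z[%classic) + leb (W `&` `]z, +oo[%classic))).
  apply: leeD.
    rewrite [leRHS](lebesgue_measure_affine ((1 - p) * y)%R p0)//.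
    rewrite lee_wpmul2l// le_measure ?inE//.
    - by apply: measurableI => //; exact: measurable_itv.
    - exact: maff.
    - move=> t [Xt] /=; rewrite !in_itv/= => tx; split; first exact: XYW.
      by rewrite ltrD2r ltr_pM2l.
  rewrite [leRHS](lebesgue_measure_affine (p * x)%R q0)//.
  rewrite lee_wpmul2l// le_measure ?inE//.
  - by apply: measurableI => //; exact: measurable_itv.
  - exact: maff.
  - move=> t [Yt] /=; rewrite !in_itv/= !andbT => ty; rewrite addrC.
    by split; [exact: XYW|rewrite ltrD2l ltr_pM2l].
rewrite -measureU//; last first.
  apply/seteqP; split => // t [[_ /=] + [_ /=]]; rewrite !in_itv/= andbT.
  by move=> /lt_trans /[apply]; rewrite ltxx.
by rewrite le_measure ?inE//; [exact: measurableU|move=> t [[]|[]]].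
Qed.

End brunn_minkowski_line.

(** * The Prekopa-Leindler inequality on the line *)

Section prekopa_leindler_line.
Context (R : realType) (p : R).
Hypothesis p01 : (0 < p < 1)%R.
Notation leb := (@lebesgue_measure R).
Implicit Types F G M : measurableTypeR R -> \bar R.
Local Open Scope ereal_scope.

Let p0 : (0 < p)%R. Proof. by case/andP: p01. Qed.
Let q0 : (0 < 1 - p)%R. Proof. by case/andP: p01 => _; rewrite subr_gt0. Qed.
Let pE : 0 <= p%:E. Proof. by rewrite lee_fin ltW. Qed.
Let qE : 0 <= (1 - p)%:E. Proof. by rewrite lee_fin ltW. Qed.

(* With suprema equal to 1, the superlevel sets of F and G at a height s < 1 are
   both nonempty, and their combinations lie in that of M. Integrating the
   Brunn-Minkowski inequality over s gives an arithmetic mean. *)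
Let prekopa_leindler_normalized F G M :
  measurable_fun [set: measurableTypeR R] F ->
  measurable_fun [set: measurableTypeR R] G ->
  measurable_fun [set: measurableTypeR R] M ->
  (forall x, 0 <= F x <= 1) -> (forall x, 0 <= G x <= 1) -> (forall x, 0 <= M x) ->
  (forall r : R, (r < 1)%R -> exists x, r%:E < F x) ->
  (forall r : R, (r < 1)%R -> exists x, r%:E < G x) ->
  (forall x y, F x `^ p * G y `^ (1 - p) <= M (p * x + (1 - p) * y)%R) ->
  p%:E * \int[leb]_x F x + (1 - p)%:E * \int[leb]_x G x <= \int[leb]_x M x.
Proof.
move=> mF mG mM F01 G01 M0 supF supG FGM.
have F0 x : 0 <= F x by case/andP: (F01 x).
have G0 x : 0 <= G x by case/andP: (G01 x).
rewrite (layer_cake leb mF F0) (layer_cake leb mG G0) (layer_cake leb mM M0).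
rewrite -!ge0_integralZl//; try exact: measurable_level_measure.
rewrite -ge0_integralD//; try by [move=> s _; exact: mule_ge0|
  apply: measurable_funeM; exact: measurable_level_measure].
apply: ge0_le_integral => //.
- by move=> s _; rewrite adde_ge0// mule_ge0.
- by apply: emeasurable_funD; apply: measurable_funeM; exact: measurable_level_measure.
- exact: measurable_level_measure.
move=> s _.
have [s0|s0] := ltP s 0%R.
  have e H : [set x : measurableTypeR R | 0 <= s%:E /\ s%:E < H x] = set0.
    by apply/seteqP; split => x //=; rewrite lee_fin leNgt s0 => -[].
  by rewrite !e !measure0 !mule0 adde0.
have [s1|s1] := leP 1%R s.
  have e H : (forall x, 0 <= H x <= 1) ->
      [set x : measurableTypeR R | 0 <= s%:E /\ s%:E < H x] = set0.
    move=> H01; apply/seteqP; split => x //= [_]; apply/negP; rewrite -leNgt.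
    by case/andP: (H01 x) => _ /le_trans; apply; rewrite lee_fin.
  by rewrite (e F)// (e G)// !measure0 !mule0 adde0.
apply: brunn_minkowski_line => //.
- exact: measurable_level.
- exact: measurable_level.
- exact: measurable_level.
- by have [x Fx] := supF _ s1; exists x.
- by have [x Gx] := supG _ s1; exists x.
- move=> x y [_ sx] [_ sy]; split; first by rewrite lee_fin.
  by apply: lt_le_trans (FGM x y); exact: lt_poweR_geo.
Qed.

(* Dividing by the suprema normalises the functions; the inequality of means
   then replaces the arithmetic mean by a geometric one, which no longer depends
   on the normalisation. *)
Let prekopa_leindler_bounded F G M (A B : R) :
  measurable_fun [set: measurableTypeR R] F ->
  measurable_fun [set: measurableTypeR R] G ->
  measurable_fun [set: measurableTypeR R] M ->
  (forall x, 0 <= F x <= A%:E) -> (forall x, 0 <= G x <= B%:E) ->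
  (forall x, 0 <= M x) ->
  (forall x y, F x `^ p * G y `^ (1 - p) <= M (p * x + (1 - p) * y)%R) ->
  (\int[leb]_x F x) `^ p * (\int[leb]_x G x) `^ (1 - p) <= \int[leb]_x M x.
Proof.
move=> mF mG mM F0A G0B M0 FGM.
have supP H C : (forall x, 0 <= H x <= C%:E) -> \int[leb]_x H x = 0 \/
    exists2 a : R, (0 < a)%R & (forall x, H x <= a%:E) /\
      forall r : R, (r < a)%R -> exists x, r%:E < H x.
  move=> H0C; pose S := ereal_sup (range H).
  have HS x : H x <= S by apply: ereal_sup_ubound; exists x.
  have SC : S <= C%:E.
    by apply: ge_ereal_sup => _ [x _ <-]; case/andP: (H0C x).
  have S0 : 0 <= S by apply: le_trans (HS 0%R); case/andP: (H0C 0%R).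
  have Sfin : S \is a fin_num by rewrite ge0_fin_numE// (le_lt_trans SC)// ltry.
  have [Sz|SN0] := eqVneq S 0.
    left; rewrite (eq_integral (cst 0)) ?integral0// => x _ /=.
    by apply/eqP; rewrite eq_le -{1}Sz HS; case/andP: (H0C x).
  right; exists (fine S).
    by rewrite fine_gt0// lt_neqAle eq_sym SN0 S0 (le_lt_trans SC)// ltry.
  rewrite fineK//; split => // r rS.
  have : r%:E < S by rewrite -(fineK Sfin) lte_fin.
  by move=> /ereal_sup_gt[_ [x _ <-] rx]; exists x.
have [->|[a a0 [Fa supF]]] := supP F A F0A.
  by rewrite poweR0r ?gt_eqF// mul0e integral_ge0.
have [->|[b b0 [Gb supG]]] := supP G B G0B.
  by rewrite [X in _ * X]poweR0r ?gt_eqF// mule0 integral_ge0.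
have F0 x : 0 <= F x by case/andP: (F0A x).
have G0 x : 0 <= G x by case/andP: (G0B x).
pose c := (a `^ p * b `^ (1 - p))%R.
have c0 : (0 < c)%R by rewrite mulr_gt0// powR_gt0.
have ia0 : (0 <= a^-1)%R by rewrite invr_ge0 ltW.
have ib0 : (0 <= b^-1)%R by rewrite invr_ge0 ltW.
have ic0 : (0 <= c^-1)%R by rewrite invr_ge0 ltW.
have invpow x r : (0 <= x -> x^-1 `^ r = (x `^ r)^-1)%R.
  by move=> x0; rewrite -(powR_inv1 x0) -powRrM mulN1r powRN.
have cE (u v : \bar R) : 0 <= u -> 0 <= v ->
   (a^-1%:E * u) `^ p * (b^-1%:E * v) `^ (1 - p) =
   c^-1%:E * (u `^ p * v `^ (1 - p)).
  move=> u0 v0; rewrite poweR_geoM//; congr (_%:E * _).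
  by rewrite /c invfM !invpow// ltW.
have PL : p%:E * \int[leb]_x (a^-1%:E * F x) +
    (1 - p)%:E * \int[leb]_x (b^-1%:E * G x) <= \int[leb]_x (c^-1%:E * M x).
  apply: prekopa_leindler_normalized => //.
  - exact: measurable_funeM.
  - exact: measurable_funeM.
  - exact: measurable_funeM.
  - by move=> x; rewrite mule_ge0 ?lee_fin// muleC lee_pdivrMr// mul1e/= Fa.
  - by move=> x; rewrite mule_ge0 ?lee_fin// muleC lee_pdivrMr// mul1e/= Gb.
  - by move=> x; rewrite mule_ge0 ?lee_fin.
  - move=> r r1; have [|x rx] := supF (r * a)%R; first by rewrite gtr_pMl.
    by exists x; rewrite muleC lte_pdivlMr// -EFinM.
  - move=> r r1; have [|x rx] := supG (r * b)%R; first by rewrite gtr_pMl.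
    by exists x; rewrite muleC lte_pdivlMr// -EFinM.
  - by move=> x y; rewrite cE// lee_wpmul2l ?lee_fin.
rewrite -(@lee_pmul2l _ c^-1%:E)// ?lte_fin ?invr_gt0//.
rewrite -cE ?integral_ge0//.
move: PL; rewrite !ge0_integralZl_EFin//.
apply: le_trans.
by apply: poweR_amgm => //; rewrite mule_ge0 ?integral_ge0 ?lee_fin.
Qed.

(** Cutting [F] and [G] at heights [k] and [l] keeps the hypothesis; the bounded
    case applies, and [k] and [l] tend to infinity one after the other. *)
Lemma prekopa_leindler_line F G M :
  measurable_fun [set: measurableTypeR R] F ->
  measurable_fun [set: measurableTypeR R] G ->
  measurable_fun [set: measurableTypeR R] M ->
  (forall x, 0 <= F x) -> (forall x, 0 <= G x) -> (forall x, 0 <= M x) ->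
  (forall x y, F x `^ p * G y `^ (1 - p) <= M (p * x + (1 - p) * y)%R) ->
  (\int[leb]_x F x) `^ p * (\int[leb]_x G x) `^ (1 - p) <= \int[leb]_x M x.
Proof.
move=> mF mG mM F0 G0 M0 FGM.
pose cut (H : measurableTypeR R -> \bar R) (k : nat) x := mine (H x) k%:R%:E.
have cut0 H k x : (forall x, 0 <= H x) -> 0 <= cut H k x.
  by move=> H0; rewrite /cut le_min H0/= lee_fin.
have cutH H k x : cut H k x <= H x by rewrite /cut ge_min lexx.
have mcut H k : measurable_fun [set: measurableTypeR R] H ->
    measurable_fun [set: measurableTypeR R] (cut H k).
  by move=> mH; apply: measurable_mine => //; exact: measurable_cst.
have cutcvg H x : (forall x, 0 <= H x) -> cut H ^~ x @ \oo --> H x.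
  move=> H0; rewrite /cut; case E : (H x) => [h||]; last first.
  - by have := H0 x; rewrite E.
  - apply: cvg_trans; last exact: (@cvgenyP R nat _ _ idfun).2 cvg_id.
    by apply: near_eq_cvg; apply: nearW => k; rewrite min_r ?leey.
  apply: cvg_near_cst; exists (Num.truncn `|h|).+1 => // k /= hk.
  rewrite min_l// lee_fin (le_trans (ler_norm h))//.
  by rewrite ltW// (lt_le_trans (truncnS_gt _))// ler_nat.
have cutnd H x : nondecreasing_seq (cut H ^~ x).
  move=> m n mn; rewrite /cut le_min !ge_min lexx/= lee_fin ler_nat mn.
  by rewrite orbT.
have icvg H : measurable_fun [set: measurableTypeR R] H -> (forall x, 0 <= H x) ->
    (fun k => \int[leb]_x cut H k x) @ \oo --> \int[leb]_x H x.
  move=> mH H0; rewrite (eq_integral (fun x => limn (cut H ^~ x))).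
    apply: (@cvg_monotone_convergence _ _ _ leb _ measurableT (cut H)).
    - by move=> k; exact: mcut.
    - by move=> k x _; exact: cut0.
    - by move=> x _; exact: cutnd.
  by move=> x _; apply/esym/cvg_lim => //; exact: cutcvg.
have indl H m n : (m <= n)%N -> measurable_fun [set: measurableTypeR R] H ->
    (forall x, 0 <= H x) -> \int[leb]_x cut H m x <= \int[leb]_x cut H n x.
  move=> mn mH H0; apply: ge0_le_integral => //.
  - by move=> x _; exact: cut0.
  - exact: mcut.
  - exact: mcut.
  - by move=> x _; exact: cutnd.
have i0 H k : (forall x, 0 <= H x) -> 0 <= \int[leb]_x cut H k x.
  by move=> H0; apply: integral_ge0 => x _; exact: cut0.
have bnd k l : (\int[leb]_x cut F k x) `^ p * (\int[leb]_x cut G l x) `^ (1 - p)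
    <= \int[leb]_x M x.
  apply: (@le_trans _ _ ((\int[leb]_x cut F (maxn k l) x) `^ p *
      (\int[leb]_x cut G (maxn k l) x) `^ (1 - p))).
    apply: lee_poweR_geo; rewrite ?i0//.
    - by apply: indl => //; exact: leq_maxl.
    - by apply: indl => //; exact: leq_maxr.
  apply: (@prekopa_leindler_bounded _ _ _ (maxn k l)%:R (maxn k l)%:R) => //.
  - exact: mcut.
  - exact: mcut.
  - by move=> x; rewrite cut0//= ge_min lexx orbT.
  - by move=> x; rewrite cut0//= ge_min lexx orbT.
  - move=> x y; apply: le_trans (FGM x y).
    by apply: lee_poweR_geo; rewrite ?cut0 ?cutH.
apply: poweR_mul_cvg_le p0 _ _ (icvg F mF F0) _.
- by move=> k; exact: i0.
- exact: poweR_ge0.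
move=> k; rewrite muleC.
apply: poweR_mul_cvg_le q0 _ _ (icvg G mG G0) _.
- by move=> l; exact: i0.
- exact: poweR_ge0.
by move=> l; rewrite muleC.
Qed.

End prekopa_leindler_line.

(** * The multiplicative Prekopa-Leindler inequality *)

Section prekopa_leindler_mul_line.
Context (R : realType) (p : R).
Hypothesis p01 : (0 < p < 1)%R.
Notation leb := (@lebesgue_measure R).
Local Open Scope ereal_scope.

Let half : R := 2^-1.

Let half_sum_le (a b : \bar R) : a <= b -> half%:E * (a + b) <= b.
Proof.
by move=> ab; rewrite lee_pdivrMl// mule_natl mule2n leeD2r.
Qed.

(** In the variable [t] with [x = +- expR t], the geometric mean becomes a convex
    combination, and the Jacobian [expR t] is multiplicative in the same sense.
    The two half-lines are averaged: an average is at most the larger of the two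
    values, while the lower bound on [m] holds for both signs of [z]. *)
Lemma prekopa_leindler_mul_line (f g m : measurableTypeR R -> \bar R) :
  measurable_fun [set: measurableTypeR R] f ->
  measurable_fun [set: measurableTypeR R] g ->
  measurable_fun [set: measurableTypeR R] m ->
  (forall x, 0 <= f x) -> (forall x, 0 <= g x) -> (forall x, 0 <= m x) ->
  (forall x y z : R, `|z|%R = (`|x| `^ p * `|y| `^ (1 - p))%R ->
    f x `^ p * g y `^ (1 - p) <= m z) ->
  (\int[leb]_x f x) `^ p * (\int[leb]_x g x) `^ (1 - p) <= \int[leb]_x m x.
Proof.
move=> mf mg mm f0 g0 m0 fgm.
pose E (h : measurableTypeR R -> \bar R) (t : measurableTypeR R) :=
  (expR t)%:E * (half%:E * (h (expR t) + h (- expR t)%R)).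
have half0 : (0 <= half)%R by rewrite invr_ge0.
have mE h : measurable_fun [set: measurableTypeR R] h ->
    measurable_fun [set: measurableTypeR R] (E h).
  move=> mh; apply: emeasurable_funM.
    by apply/measurable_EFinP; exact: measurable_expR.
  apply: measurable_funeM; apply: emeasurable_funD.
    by apply: (measurableT_comp mh); exact: measurable_expR.
  apply: (measurableT_comp mh).
  exact: (@measurable_funN _ (measurableTypeR R) R setT _ (@measurable_expR R)).
have avg0 h t : (forall x, 0 <= h x) -> 0 <= half%:E * (h (expR t) + h (- expR t)%R).
  by move=> h0; rewrite mule_ge0 ?lee_fin// adde_ge0.
have E0 h t : (forall x, 0 <= h x) -> 0 <= E h t.
  by move=> h0; rewrite mule_ge0 ?lee_fin ?expR_ge0// avg0.
have iE h : measurable_fun [set: measurableTypeR R] h -> (forall x, 0 <= h x) ->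
    \int[leb]_t E h t = half%:E * \int[leb]_x h x.
  move=> mh h0; rewrite (ge0_integral_exp mh h0) -ge0_integralZl_EFin//.
  - by apply: eq_integral => t _; rewrite muleCA.
  - by move=> t _; rewrite mule_ge0 ?lee_fin ?expR_ge0// adde_ge0.
  - have := mE _ mh; rewrite (_ : E h = fun t => half%:E *
      ((expR t)%:E * (h (expR t) + h (- expR t)%R))); last first.
      by apply/funext => t; rewrite muleCA.
    move=> /(measurable_funeM 2%:E); congr (measurable_fun _ _).
    by apply/funext => t; rewrite muleA -EFinM divff// mul1e.
have avgP h t : exists2 x : R, `|x|%R = expR t &
    half%:E * (h (expR t) + h (- expR t)%R) <= h x.
  have [le|/ltW le] := leP (h (expR t)) (h (- expR t)%R).
    by exists (- expR t)%R; rewrite ?normrN ?ger0_norm ?expR_ge0// half_sum_le.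
  by exists (expR t); rewrite ?ger0_norm ?expR_ge0// addeC half_sum_le.
have PL := @prekopa_leindler_line R p p01 (E f) (E g) (E m) (mE _ mf) (mE _ mg)
  (mE _ mm) (E0 f ^~ f0) (E0 g ^~ g0) (E0 m ^~ m0).
have : (forall s t, E f s `^ p * E g t `^ (1 - p) <= E m (p * s + (1 - p) * t)%R).
  move=> s t; have [x xs fx] := avgP f s; have [y yt gy] := avgP g t.
  rewrite /E poweR_geoM ?expR_ge0//; [|exact: avg0|exact: avg0].
  rewrite !expR_powR -expRD.
  apply: lee_wpmul2l; first by rewrite lee_fin expR_ge0.
  rewrite lee_pdivlMl// mule_natl mule2n.
  apply: (@le_trans _ _ (f x `^ p * g y `^ (1 - p) + f x `^ p * g y `^ (1 - p))).
    by apply: leeD; apply: lee_poweR_geo => //; exact: avg0.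
  by apply: leeD; apply: fgm; rewrite ?normrN ger0_norm ?expR_ge0// xs yt
    !expR_powR expRD.
move=> /PL; rewrite !iE// poweR_geoM ?integral_ge0// powR_geo//.
by rewrite lee_pmul2l// lte_fin invr_gt0.
Qed.

End prekopa_leindler_mul_line.

Section borel_lebesgue_integral.
Context (R : realType).
Notation leb := (@lebesgue_measure R).
Notation bl := (borel_lebesgue R).
Local Open Scope ereal_scope.

Lemma measurable_row_cons_r n (x : measurableTypeR R) (f : 'rV[R]_n.+1 -> \bar R) :
  measurable_fun [set: 'rV[R]_n.+1] f ->
  measurable_fun [set: 'rV[R]_n] (fun v => f (row_cons (x, v))).
Proof.
move=> mf; apply: (measurableT_comp mf).
apply: (measurableT_comp (@measurable_row_cons R n)).
exact: pair1_measurable.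
Qed.

Lemma measurable_partial_integral n (f : 'rV[R]_n.+1 -> \bar R) :
  measurable_fun [set: 'rV[R]_n.+1] f -> (forall x, 0 <= f x) ->
  measurable_fun [set: measurableTypeR R]
    (fun x => \int[bl n]_v f (row_cons (x, v))).
Proof.
move=> mf f0.
have mfr := measurableT_comp mf (@measurable_row_cons R n).
have := measurable_fun_fubini_tonelli_F (m2 := bl n) _ mfr (fun z => f0 _).
by [].
Qed.

Lemma integral_borel_lebesgueS n (f : 'rV[R]_n.+1 -> \bar R) :
  measurable_fun [set: 'rV[R]_n.+1] f -> (forall x, 0 <= f x) ->
  \int[bl n.+1]_x f x = \int[leb]_x \int[bl n]_v f (row_cons (x, v)).
Proof.
move=> mf f0.
have mfr := measurableT_comp mf (@measurable_row_cons R n).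
have <- := fubini_tonelli1 (m1 := leb) (m2 := bl n) _ mfr (fun z => f0 _).
have := ge0_integral_pushforward (@measurable_row_cons R n)
  (product_measure1 leb (bl n)) measurableT mf (fun x _ => f0 x).
by rewrite preimage_setT.
Qed.

Lemma row_consZ n (a x : R) (v : 'rV[R]_n) :
  (a *: row_cons (x, v) = row_cons (a * x, a *: v))%R.
Proof.
apply/rowP => i; have [j ->|->] := unliftP ord0 i.
  have := row_consS (x, v) j; have := row_consS ((a * x)%R, (a *: v)%R) j.
  by rewrite /row_coord !mxE => -> ->.
have := row_cons0 (x, v); have := row_cons0 ((a * x)%R, (a *: v)%R).
by rewrite /row_coord !mxE => -> ->.
Qed.

Lemma measurable_scale n (a : R) : measurable_fun [set: 'rV[R]_n] ( *:%R a : 'rV[R]_n -> 'rV[R]_n).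
Proof.
apply: measurable_fun_row_coordP => i.
rewrite (_ : _ \o _ = fun x => (a * row_coord i x)%R); last first.
  by apply/funext => x; rewrite /row_coord/= mxE.
by apply: measurable_funM => //; exact: measurable_row_coord.
Qed.

Lemma integral_borel_lebesgueZ n (a : R) (f : 'rV[R]_n -> \bar R) : (0 < a)%R ->
  measurable_fun [set: 'rV[R]_n] f -> (forall x, 0 <= f x) ->
  \int[bl n]_x f x = (a ^+ n)%:E * \int[bl n]_x f (a *: x)%R.
Proof.
move=> a0; elim: n f => [|n IH] f mf f0.
  by rewrite expr0 mul1e; apply: eq_integral => x _; congr f; apply/rowP => -[].
pose h x := f (a *: x)%R.
have mh : measurable_fun [set: 'rV[R]_n.+1] h.
  exact: measurableT_comp mf (measurable_scale _).
have h0 x : 0 <= h x by exact: f0.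
rewrite (integral_borel_lebesgueS mf f0) (integral_borel_lebesgueS mh h0).
have mF := measurable_partial_integral mf f0.
have mH := measurable_partial_integral mh h0.
have H0 x : 0 <= \int[bl n]_v h (row_cons (x, v)) by exact: integral_ge0.
have F0 x : 0 <= \int[bl n]_v f (row_cons (x, v)) by exact: integral_ge0.
rewrite (ge0_integral_affine 0%R a0 mF F0) exprS EFinM -muleA; congr (_ * _).
have an0 : (0 <= a ^+ n)%R by rewrite exprn_ge0// ltW.
rewrite -(ge0_integralZl_EFin leb measurableT (fun x _ => H0 x) mH an0).
apply: eq_integral => x _; rewrite addr0.
rewrite (IH _ (measurable_row_cons_r (a * x)%R mf) (fun v => f0 _)).
by congr (_ * _); apply: eq_integral => v _; rewrite /h row_consZ.
Qed.

(** Fixing the first coordinates reduces the claim to dimension [n], and the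
    integrals over the fibres satisfy its one-dimensional case. *)
Lemma prekopa_leindler_mul n (p : R) (f g m : 'rV[R]_n -> \bar R) :
  (0 < p < 1)%R ->
  measurable_fun [set: 'rV[R]_n] f -> measurable_fun [set: 'rV[R]_n] g ->
  measurable_fun [set: 'rV[R]_n] m ->
  (forall x, 0 <= f x) -> (forall x, 0 <= g x) -> (forall x, 0 <= m x) ->
  (forall x y z : 'rV[R]_n, (forall i, `|z ord0 i| =
      `|x ord0 i| `^ p * `|y ord0 i| `^ (1 - p))%R ->
    f x `^ p * g y `^ (1 - p) <= m z) ->
  (\int[bl n]_x f x) `^ p * (\int[bl n]_x g x) `^ (1 - p) <=
  \int[bl n]_x m x.
Proof.
move=> p01; elim: n f g m => [|n IH] f g m mf mg mm f0 g0 m0 fgm.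
  rewrite !integral_dirac// !diracT !mul1e.
  by apply: fgm => -[].
rewrite !integral_borel_lebesgueS//.
apply: prekopa_leindler_mul_line => //; try exact: measurable_partial_integral.
- by move=> x; exact: integral_ge0.
- by move=> x; exact: integral_ge0.
- by move=> x; exact: integral_ge0.
move=> x y z xyz; apply: IH => //; try exact: measurable_row_cons_r.
move=> u v w uvw; apply: fgm => i.
have [j ->|->] := unliftP ord0 i.
  have := row_consS (x, u) j; have := row_consS (y, v) j.
  by have := row_consS (z, w) j; rewrite /row_coord => -> -> ->; exact: uvw.
have := row_cons0 (x, u); have := row_cons0 (y, v).
by have := row_cons0 (z, w); rewrite /row_coord => -> -> ->.
Qed.

End borel_lebesgue_integral.

(** * Solid sets and functions *)

Section rational_envelope.
Context (R : realType) (n : nat).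
Notation bl := (borel_lebesgue R n).
Notation V := 'rV[R]_n.

Definition dominated (y x : V) := forall i, `|y ord0 i| <= `|x ord0 i|.

Definition ratr_row (q : 'rV[rat]_n) : V := map_mx ratr q.

(** The union of the boxes with a rational corner in [A]. Being a countable union
    it is Borel, and it fills [A] up to a dilation when [A] is an ideal. *)
Definition inner (A : set V) : set V :=
  \bigcup_(q in [set q | A (ratr_row q)]) [set x | dominated x (ratr_row q)].

Lemma measurable_dominated (b : V) : measurable [set x | dominated x b].
Proof.
rewrite (_ : [set x | _] = \bigcap_(i in [set: 'I_n])
    [set x | `|row_coord i x| <= `|b ord0 i|]); last first.
  by apply/seteqP; split => x /= xq i; [move=> _|]; exact: xq.
apply: fin_bigcap_measurable => // i _.
have mabs : measurable_fun [set: V] (fun x => `|row_coord i x|).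
  by apply: measurableT_comp => //; exact: measurable_row_coord.
rewrite -[X in measurable X]setTI.
rewrite (_ : [set x | _] = (fun x => `|row_coord i x|) @^-1`
    `]-oo, `|b ord0 i|]%classic); last first.
  by apply/seteqP; split => x /=; rewrite in_itv.
exact: mabs.
Qed.

Lemma measurable_inner A : measurable (inner A).
Proof.
rewrite /inner bigcup_mkcond; apply: countable_bigcupT_measurable => // q.
by case: ifPn => // _; exact: measurable_dominated.
Qed.

Lemma rational_dominating (x : V) : exists q, dominated x (ratr_row q).
Proof.
have /choice[q xq] : forall i, exists q : rat, `|x ord0 i| <= `|ratr q : R|.
  move=> i; have [|q] := @rat_in_itvoo R `|x ord0 i| (`|x ord0 i| + 1).
    by rewrite ltrDl.
  rewrite in_itv/= => /andP[xq _]; exists q.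
  by rewrite ltW// (lt_le_trans xq)// ler_norm.
by exists (\row_i q i) => i; rewrite !mxE.
Qed.

(** A vanishing coordinate of [x] is matched by the rational number 0, so the
    interpolation also works on the coordinate hyperplanes. *)
Lemma rational_between (t : R) (x : V) : 0 < t < 1 ->
  exists2 q, dominated (t *: x) (ratr_row q) & dominated (ratr_row q) x.
Proof.
move=> /andP[t0 t1].
have /choice[q xq] : forall i, exists q : rat,
    t * `|x ord0 i| <= `|ratr q : R| <= `|x ord0 i|.
  move=> i; have [->|xi0] := eqVneq (x ord0 i) 0.
    by exists 0; rewrite rmorph0 normr0 mulr0 lexx.
  have [|q] := @rat_in_itvoo R (t * `|x ord0 i|) `|x ord0 i|.
    by rewrite gtr_pMl// normr_gt0.
  rewrite in_itv/= => /andP[xq qx]; exists q.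
  rewrite (@ger0_norm _ (ratr q)) ?(ltW xq) ?(ltW qx)//.
  by rewrite (le_trans _ (ltW xq))// mulr_ge0// ltW.
exists (\row_i q i) => i; rewrite !mxE; last by case/andP: (xq i).
by rewrite normrM (gtr0_norm t0); case/andP: (xq i).
Qed.

Local Open Scope ereal_scope.

Definition solid_fun (f : V -> \bar R) :=
  forall x y, dominated y x -> f x <= f y.

(** The function whose superlevel sets are the [inner] sets of those of [f]. *)
Definition inner_fun (f : V -> \bar R) (x : V) : \bar R :=
  ereal_sup [set f (ratr_row q) | q in [set q | dominated x (ratr_row q)]].

Lemma measurable_inner_fun f : measurable_fun [set: V] (inner_fun f).
Proof.
move=> mD; apply: (measurability _ (ErealGenOInfty.measurableE R)) => //.
move=> _ [_ [r ->] <-]; rewrite setTI.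
rewrite (_ : _ @^-1` _ = inner [set x | r%:E < f x]); first exact: measurable_inner.
apply/seteqP; split => x /=.
  rewrite in_itv/= andbT => /ereal_sup_gt[_ [q xq <-] rf].
  by exists q.
move=> [q /= rf xq]; rewrite in_itv/= andbT; apply: (lt_le_trans rf).
by apply: ereal_sup_ubound; exists q.
Qed.

Lemma inner_fun_ge0 f x : (forall x, 0 <= f x) -> 0 <= inner_fun f x.
Proof.
move=> f0; have [q xq] := rational_dominating x.
by apply: (le_trans (f0 (ratr_row q))); apply: ereal_sup_ubound; exists q.
Qed.

Lemma inner_fun_le f x : solid_fun f -> inner_fun f x <= f x.
Proof. by move=> sf; apply: ge_ereal_sup => _ [q xq <-]; exact: sf. Qed.

Lemma le_inner_fun_scale f t x : solid_fun f -> (0 < t < 1)%R ->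
  f x <= inner_fun f (t *: x)%R.
Proof.
move=> sf t01; have [q tq qx] := rational_between x t01.
by apply: (le_trans (sf _ _ qx)); apply: ereal_sup_ubound; exists q.
Qed.

End rational_envelope.

(** Dilation factors that increase to 1. *)
Definition shrink (R : realType) (k : nat) : R := 1 - k.+2%:R^-1.

Lemma shrink01 (R : realType) k : 0 < shrink R k < 1.
Proof.
rewrite /shrink subr_gt0 invf_lt1 ?ltr0n// ltr1n/= ltrBlDr ltrDl.
by rewrite invr_gt0 ltr0n.
Qed.

Lemma cvg_shrink (R : realType) : shrink R @ \oo --> (1 : R).
Proof.
rewrite -[X in _ --> X]subr0; apply: cvgB; first exact: cvg_cst.
by have := @cvg_harmonic R; rewrite -cvg_shiftS; exact.
Qed.

Lemma lee_shrink (R : realType) n (a b : \bar R) :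
  (forall k, (shrink R k ^+ n)%:E * a <= b)%E -> (a <= b)%E.
Proof.
move=> tab.
have tn : (fun k => shrink R k ^+ n) @ \oo --> (1 : R).
  have := @exprn_continuous R n 1; rewrite /continuous_at expr1n => c.
  exact: (cvg_comp _ _ (@cvg_shrink R) c).
case: a tab => [a||] tab; last by rewrite leNye.
- have ta : (fun k => (shrink R k ^+ n * a)%:E) @ \oo --> a%:E.
    apply: cvg_EFin; first exact: nearW.
    by rewrite -[X in _ --> X]mul1r; apply: cvgMr_tmp.
  apply: cvge_to_le ta _; apply: nearW => k.
  by rewrite EFinM; exact: tab.
- have := tab 0; rewrite gt0_muley// lte_fin exprn_gt0//.
  by case/andP: (shrink01 R 0).
Qed.

(** The integral of a nonnegative function is a supremum over the simple
    functions below it. This compares the density with Borel functions before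
    anything is known about its measurability. *)
Lemma ge0_le_integral_total d (T : measurableType d) (R : realType)
    (mu : {measure set T -> \bar R}) (f g : T -> \bar R) :
  (forall x, 0 <= f x)%E -> (forall x, f x <= g x)%E ->
  (\int[mu]_x f x <= \int[mu]_x g x)%E.
Proof.
move=> f0 fg; have g0 x : (0 <= g x)%E by exact: le_trans (fg x).
rewrite !ge0_integralTE//; apply: ereal_sup_le => _ [h hf <-].
by exists h => // x; exact: le_trans (fg x).
Qed.

Section completion.
Context (R : realType) (n : nat).
Notation bl := (borel_lebesgue R n).
Notation V := 'rV[R]_n.
Notation lebn := (@lebesgue_measureRn R n).
Local Open Scope ereal_scope.

Lemma measurable_lebesgueRn (A : set V) :
  measurable A -> measurable (A : set (lebesgueRn R n)).
Proof. by move=> mA; exact: caratheodory_measurable_mu_ext. Qed.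

Lemma lebesgue_measureRnE (A : set V) : measurable A -> lebn A = bl A.
Proof. by move=> mA; exact: measurable_mu_extE. Qed.

Lemma integral_lebesgueRn (h : V -> \bar R) :
  measurable_fun [set: V] h -> (forall x, 0 <= h x) ->
  \int[lebn]_x h x = \int[bl]_x h x.
Proof.
move=> mh h0.
pose phi (x : lebesgueRn R n) : V := x.
have mphi : measurable_fun [set: lebesgueRn R n] phi.
  by move=> _ Y mY; rewrite setTI; exact: measurable_lebesgueRn.
have := ge0_integral_pushforward mphi lebn measurableT mh (fun x _ => h0 x).
rewrite preimage_setT => /= <-.
apply: eq_measure_integral => A mA _; exact: lebesgue_measureRnE.
Qed.

Lemma measurable_inner_fun_scale f (t : R) :
  measurable_fun [set: V] (fun x => inner_fun f (t *: x)%R).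
Proof.
exact: measurableT_comp (@measurable_inner_fun R n f) (@measurable_scale R n t).
Qed.

(** The function lies between its inner envelope and the dilates of the latter,
    whose integrals differ by the factor [t ^- n], with [t < 1] arbitrarily close
    to 1. *)
Lemma integral_solid (f : V -> \bar R) : solid_fun f -> (forall x, 0 <= f x) ->
  \int[lebn]_x f x = \int[bl]_x inner_fun f x.
Proof.
move=> sf f0.
have i0 x : 0 <= inner_fun f x by exact: inner_fun_ge0.
apply/eqP; rewrite eq_le; apply/andP; split; last first.
  rewrite -integral_lebesgueRn//; last exact: measurable_inner_fun.
  by apply: ge0_le_integral_total => // x; exact: inner_fun_le.
apply: (@lee_shrink _ n) => k; have /andP[t0 _] := shrink01 R k.
rewrite [leRHS](integral_borel_lebesgueZ t0)//; last exact: measurable_inner_fun.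
apply: lee_wpmul2l; first by rewrite lee_fin exprn_ge0// ltW.
rewrite -integral_lebesgueRn//; last exact: measurable_inner_fun_scale.
apply: ge0_le_integral_total => // x; apply: le_inner_fun_scale => //.
exact: shrink01.
Qed.

Lemma borel_lebesgueZ (a : R) (D : set V) : (0 < a)%R -> measurable D ->
  bl D = (a ^+ n)%:E * bl [set x | D (a *: x)%R].
Proof.
move=> a0 mD.
have mDa : measurable [set x | D (a *: x)%R].
  by rewrite -[X in measurable X]setTI; exact: measurable_scale.
have := @integral_borel_lebesgueZ R n a (EFin \o \1_D) a0.
rewrite integral_indic// setIT => ->//.
- rewrite -[in RHS](setIT [set x | _]) -integral_indic//.
- by apply/measurable_EFinP; exact: measurable_indic.
- by move=> x /=; rewrite lee_fin.
Qed.

End completion.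

Definition cube (R : realType) (n : nat) (r : R) : set 'rV[R]_n :=
  [set x | dominated x (const_mx r)].

Arguments cube {R} n r.

Lemma borel_lebesgue_cube_fin (R : realType) n (r : R) :
  (borel_lebesgue R n (cube n r) < +oo)%E.
Proof.
elim: n => [|n IH].
  rewrite /= (_ : cube 0 r = setT) ?diracT ?ltry//.
  by apply/seteqP; split => x // _ -[].
have mc m : measurable (cube m r) by exact: measurable_dominated.
pose I : set (measurableTypeR R) := `[- `|r|, `|r|]%classic.
have mI : measurable I by exact: measurable_itv.
have cubeE x v : cube n.+1 r (row_cons (x, v)) <-> I x /\ cube n r v.
  have e0 := row_cons0 (x, v); have eS := row_consS (x, v).
  rewrite /row_coord in e0 eS; rewrite /I/= in_itv/= -ler_norml; split.
    move=> c; split; first by have := c ord0; rewrite e0 mxE.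
    by move=> i; have := c (lift ord0 i); rewrite eS !mxE.
  move=> [xr vr] i; have [j ->|->] := unliftP ord0 i; last by rewrite e0 mxE.
  by have := vr j; rewrite eS !mxE.
rewrite -[X in (borel_lebesgue _ _ X < _)%E]setIT -integral_indic//; last first.
  exact: mc.
have mI1 : measurable_fun [set: 'rV[R]_n.+1]
    (fun x => (\1_(cube n.+1 r) x)%:E : \bar R).
  by apply/measurable_EFinP; exact: measurable_indic (mc _).
have I0 x : (0 <= (\1_(cube n.+1 r) x : R)%:E)%E by rewrite lee_fin.
rewrite (integral_borel_lebesgueS mI1 I0).
rewrite (eq_integral (fun x => borel_lebesgue R n (cube n r) * (\1_I x)%:E))%E; last first.
  have cE : (borel_lebesgue R n (cube n r) =
      \int[borel_lebesgue R n]_v (\1_(cube n r) v)%:E)%E.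
    by rewrite integral_indic ?setIT//; exact: mc.
  move=> x _; rewrite cE muleC.
  rewrite -ge0_integralZl//; last first.
    by apply/measurable_EFinP; exact: measurable_indic (mc _).
  apply: eq_integral => v _; rewrite -EFinM; congr (_%:E); rewrite !indicE.
  rewrite -natrM mulnb; congr (nat_of_bool _)%:R.
  by apply/idP/andP; rewrite !inE => /cubeE.
rewrite ge0_integralZl//; last by apply/measurable_EFinP; exact: measurable_indic.
rewrite integral_indic ?setIT//.
have If : (lebesgue_measure I < +oo)%E.
  by rewrite lebesgue_measure_itv/=; case: ifP => // _; rewrite -EFinB ltry.
by apply: lte_mul_pinfty => //; rewrite ge0_fin_numE.
Qed.

Definition solid_set (R : realType) n (A : set 'rV[R]_n) :=
  forall x y, dominated y x -> A x -> A y.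

(** Inside a cube, the set lies between its inner envelope [D] and the
    intersection [E] of the dilates of [D]. These are Borel sets of the same finite
    measure, so the difference is negligible for the complete measure. *)
Lemma solid_set_measurable (R : realType) n (A : set 'rV[R]_n) :
  solid_set A -> measurable (A : set (lebesgueRn R n)).
Proof.
move=> sA.
have AE : A = \bigcup_N (A `&` cube n N%:R).
  apply/seteqP; split => [x Ax|x [N _ []]//].
  exists (\max_i Num.truncn `|x ord0 i|).+1 => //; split => // i.
  rewrite mxE normr_nat (le_trans (ltW (truncnS_gt `|x ord0 i|)))//.
  by rewrite ler_nat ltnS (leq_bigmax i).
rewrite AE; apply: bigcupT_measurable => N.
set B := A `&` _.
have sB : solid_set B.
  move=> x y yx [Ax cx]; split; first exact: sA Ax.
  by move=> i; apply: le_trans (yx i) (cx i).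
pose D := inner B; have mD : measurable D by exact: measurable_inner.
have DB : D `<=` B by move=> x [q /= Bq xq]; exact: sB Bq.
pose E := \bigcap_k [set x | D (shrink R k *: x)].
have mE k : measurable [set x | D (shrink R k *: x)].
  by rewrite -[X in measurable X]setTI; exact: measurable_scale.
have BE : B `<=` E.
  move=> x Bx k _ /=; have [q xq qx] := rational_between x (shrink01 R k).
  by exists q => //=; exact: sB Bx.
have mE' : measurable E by exact: bigcapT_measurable.
have DE : D `<=` E by exact: subset_trans BE.
have Dfin : (borel_lebesgue R n D < +oo)%E.
  apply: le_lt_trans (borel_lebesgue_cube_fin n N%:R).
  by rewrite le_measure ?inE//; [exact: measurable_dominated|move=> x /DB[]].
have ED : (borel_lebesgue R n E <= borel_lebesgue R n D)%E.
  apply: (@lee_shrink _ n) => k; have /andP[t0 _] := shrink01 R k.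
  rewrite [leRHS](borel_lebesgueZ t0 mD); apply: lee_wpmul2l.
    by rewrite lee_fin exprn_ge0// ltW.
  by rewrite le_measure ?inE// => x; exact.
have ED0 : borel_lebesgue R n (E `\` D) = 0%E.
  rewrite measureD//; last exact: le_lt_trans ED Dfin.
  have EDe : borel_lebesgue R n E = borel_lebesgue R n D.
    by apply/eqP; rewrite eq_le ED le_measure ?inE.
  rewrite setIidr//.
  apply: etrans (congr1 (fun u => u - borel_lebesgue R n D)%E EDe) _.
  by rewrite subee// ge0_fin_numE.
rewrite -(setDUK DB); apply: measurableU; first exact: measurable_lebesgueRn.
apply: measure_is_complete_caratheodory; exists (E `\` D); split.
- by apply: measurable_lebesgueRn; exact: measurableD.
- by rewrite -ED0; apply: lebesgue_measureRnE; exact: measurableD.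
- by move=> x [/BE].
Qed.

(** * The multiplicative inequality for Lebesgue measure *)

Section abstract_inequalities.
Context (R : realType) (n : nat).
Notation V := 'rV[R]_n.
Notation lebn := (@lebesgue_measureRn R n).
Local Open Scope ereal_scope.

(** The envelopes of [f] and [g] lie below them, and a slight dilate of that of
    [m] lies above [m]: the hypothesis passes to these Borel functions, and the
    dilation only costs a factor close to 1. *)
Lemma solid_prekopa_leindler (p c : R) (f g m : V -> \bar R) :
  (0 < p < 1)%R -> (0 < c)%R ->
  solid_fun f -> solid_fun g -> solid_fun m ->
  (forall x, 0 <= f x) -> (forall x, 0 <= g x) -> (forall x, 0 <= m x) ->
  (forall x y z : V, (forall i, `|z ord0 i| =
      `|x ord0 i| `^ p * `|y ord0 i| `^ (1 - p))%R ->
    f x `^ p * g y `^ (1 - p) <= m (c *: z)%R) ->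
  (c ^+ n)%:E * ((\int[lebn]_x f x) `^ p * (\int[lebn]_x g x) `^ (1 - p)) <=
  \int[lebn]_x m x.
Proof.
move=> p01 c0 sf sg sm f0 g0 m0 fgm; rewrite !integral_solid//.
apply: (@lee_shrink _ n) => k; have t01 := shrink01 R k; have /andP[t0 _] := t01.
have tc0 : (0 < shrink R k * c)%R by rewrite mulr_gt0.
have i0 (h : V -> \bar R) : (forall x, 0 <= h x) -> forall x, 0 <= inner_fun h x.
  by move=> h0 x; exact: inner_fun_ge0.
rewrite muleA -EFinM -exprMn [leRHS](integral_borel_lebesgueZ tc0)//; last 2 first.
- exact: measurable_inner_fun.
- exact: i0.
apply: lee_wpmul2l; first by rewrite lee_fin exprn_ge0// ltW.
apply: prekopa_leindler_mul => //; try exact: measurable_inner_fun.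
- exact: measurable_inner_fun_scale.
- exact: i0.
- exact: i0.
- by move=> x; exact: i0.
move=> x y z xyz; rewrite -scalerA.
apply: (@le_trans _ _ (m (c *: z)%R)); last exact: le_inner_fun_scale.
apply: le_trans (fgm x y z xyz).
by apply: lee_poweR_geo; rewrite ?i0 ?inner_fun_le.
Qed.

Lemma solid_integral_dilation (c : R) (f m : V -> \bar R) : (0 < c)%R ->
  solid_fun f -> solid_fun m -> (forall x, 0 <= f x) -> (forall x, 0 <= m x) ->
  (forall x, f x <= m (c *: x)%R) ->
  (c ^+ n)%:E * \int[lebn]_x f x <= \int[lebn]_x m x.
Proof.
move=> c0 sf sm f0 m0 fm; rewrite !integral_solid//.
apply: (@lee_shrink _ n) => k; have t01 := shrink01 R k; have /andP[t0 _] := t01.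
have tc0 : (0 < shrink R k * c)%R by rewrite mulr_gt0.
have i0 (h : V -> \bar R) : (forall x, 0 <= h x) -> forall x, 0 <= inner_fun h x.
  by move=> h0 x; exact: inner_fun_ge0.
rewrite muleA -EFinM -exprMn [leRHS](integral_borel_lebesgueZ tc0)//; last 2 first.
- exact: measurable_inner_fun.
- exact: i0.
apply: lee_wpmul2l; first by rewrite lee_fin exprn_ge0// ltW.
apply: ge0_le_integral_total; first exact: i0.
move=> x; rewrite -scalerA; apply: (le_trans (inner_fun_le _ sf)).
by apply: (le_trans (fm x)); exact: le_inner_fun_scale.
Qed.

End abstract_inequalities.

(** * Unconditional convex functions *)

Section unconditional_convex.
Context (R : realType) (n : nat).
Notation V := 'rV[R]_n.

Lemma dominatedP (x y : V) : dominated y x ->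
  exists2 delta : 'I_n -> R, (forall i, `|delta i| <= 1) &
    forall i, y ord0 i = delta i * x ord0 i.
Proof.
move=> yx.
exists (fun i => if x ord0 i == 0 then 0 else y ord0 i / x ord0 i) => i.
  case: eqP => [_|/eqP xi0]; first by rewrite normr0.
  by rewrite normrM normfV ler_pdivrMr ?normr_gt0// mul1r yx.
case: eqP => [xi0|/eqP xi0]; last by rewrite divfK.
by have := yx i; rewrite xi0 normr0 normr_le0 mulr0 => /eqP.
Qed.

Lemma ideal_solid (A : set V) : ideal A -> solid_set A.
Proof.
move=> hA x y /dominatedP[delta delta1 yE] Ax.
rewrite (_ : y = \row_i (delta i * x ord0 i)).
  by apply: hA => // i; rewrite -ler_norml.
by apply/rowP => i; rewrite mxE yE.
Qed.

(** Scaling one coordinate by a factor between -1 and 1 is an average of leaving it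
    alone and of changing its sign, neither of which changes the value; the
    coordinates are scaled one after the other. *)
Lemma convex_unconditional_solid (U : V -> \bar R) :
  convex_ereal U -> unconditional U ->
  forall x y, dominated y x -> (U y <= U x)%E.
Proof.
move=> [UNy Uconv] Uunc x y /dominatedP[delta delta1 yE].
have step (i : 'I_n) (d : R) (u : V) : `|d| <= 1 ->
    (U (\row_j (if j == i then d * u ord0 j else u ord0 j))%R <= U u)%E.
  rewrite ler_norml => /andP[d1 d2].
  pose eps j : R := if j == i then -1 else 1.
  have eps1 j : eps j = 1 \/ eps j = -1 by rewrite /eps; case: ifP; [right|left].
  have t01 : 0 <= (1 + d) / 2 <= 1 by apply/andP; split; lra.
  have := Uconv u (\row_j (eps j * u ord0 j)) _ t01; rewrite Uunc//.
  rewrite (_ : _ + _ = \row_j (if j == i then d * u ord0 j else u ord0 j)); last first.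
    by apply/rowP => j; rewrite !mxE /eps; case: ifP => _; field.
  move=> /le_trans; apply; have := UNy u; case: (U u) => [r||]// _.
    by rewrite -!EFinM -EFinD lee_fin; lra.
  by rewrite leey.
have Uk k : (U (\row_j (if (j < k)%N then y ord0 j else x ord0 j))%R <= U x)%E.
  elim: k => [|k IH].
    by rewrite (_ : \row_j _ = x)//; apply/rowP => j; rewrite mxE.
  have [kn|nk] := ltnP k n; last first.
    apply: le_trans IH; rewrite (_ : \row_j _ =
      \row_j (if (j < k)%N then y ord0 j else x ord0 j))//.
    apply/rowP => j; rewrite !mxE (leq_trans (ltn_ord j) nk).
    by rewrite (leq_trans (ltn_ord j))// leqW.
  apply: le_trans IH.
  pose z m : V := \row_j (if (j < m)%N then y ord0 j else x ord0 j).
  have := step (Ordinal kn) _ (z k) (delta1 (Ordinal kn)).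
  congr (U _ <= _)%E; apply/rowP => j; rewrite /z !mxE -val_eqE/= [in RHS]ltnS [in RHS]leq_eqVlt.
  case: eqP => [jk|]//=; rewrite jk ltnn yE.
  by congr (delta _ * x _ _); apply: val_inj.
have := Uk n; rewrite (_ : \row_j _ = y)//.
by apply/rowP => j; rewrite mxE ltn_ord.
Qed.

Local Open Scope ereal_scope.

Lemma convex_geo_mean (U : V -> \bar R) (p : R) (x y : V) : convex_ereal U ->
  (0 < p < 1)%R ->
  expeR (- U x) `^ p * expeR (- U y) `^ (1 - p) <=
  expeR (- U (p *: x + (1 - p) *: y)%R).
Proof.
move=> [UNy Uconv] p01; have /andP[p0 p1] := p01.
have q0 : (0 < 1 - p)%R by rewrite subr_gt0.
have p01' : (0 <= p <= 1)%R by rewrite !ltW.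
have := Uconv x y p p01'.
move: (UNy x) (UNy y) (UNy (p *: x + (1 - p) *: y)%R).
case: (U x) => [a||]// _; last first.
  by move=> _ _ _; rewrite poweR0r ?gt_eqF// mul0e expeR_ge0.
case: (U y) => [b||]// _; last first.
  by move=> _ _; rewrite [X in _ * X]poweR0r ?gt_eqF// mule0 expeR_ge0.
case: (U _) => [w||]// _; rewrite -!EFinM -EFinD lee_fin => wab.
by rewrite !expR_powR -expRD lee_fin ler_expR; lra.
Qed.

End unconditional_convex.

(** * The optimal exponent *)

Section optimal_exponent.
Context (R : realType).

(** [exp (- D)], where [D] is the relative entropy of the weights [p, 1 - p] with
    respect to [l, 1 - l]. *)
Definition geo_const (l p : R) : R := (l / p) `^ p * ((1 - l) / (1 - p)) `^ (1 - p).

Lemma geo_const_le1 (l p : R) : 0 < l < 1 -> 0 < p < 1 -> geo_const l p <= 1.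
Proof.
move=> /andP[l0 l1] /[dup] p01 /andP[p0 p1].
have q0 : 0 < 1 - p by rewrite subr_gt0.
have k0 : 0 < 1 - l by rewrite subr_gt0.
have lp : 0 <= l / p by rewrite divr_ge0// ltW.
have kq : 0 <= (1 - l) / (1 - p) by rewrite divr_ge0// ltW.
apply: le_trans (powR_amgm p01 lp kq) _.
by rewrite (mulrC p) (mulrC (1 - p)) !divfK ?gt_eqF// addrC subrK.
Qed.

Lemma geo_const_gt0 (l p : R) : 0 < l < 1 -> 0 < p < 1 -> 0 < geo_const l p.
Proof.
move=> /andP[l0 l1] /andP[p0 p1].
by rewrite mulr_gt0// powR_gt0// divr_gt0// subr_gt0.
Qed.

Lemma geo_const_mean (l p x y : R) : 0 < l < 1 -> 0 < p < 1 -> 0 <= x -> 0 <= y ->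
  geo_const l p * (x `^ p * y `^ (1 - p)) <= l * x + (1 - l) * y.
Proof.
move=> /andP[l0 l1] /[dup] p01 /andP[p0 p1] x0 y0.
have q0 : 0 < 1 - p by rewrite subr_gt0.
have k0 : 0 < 1 - l by rewrite subr_gt0.
have lp : 0 <= l / p by rewrite divr_ge0// ltW.
have kq : 0 <= (1 - l) / (1 - p) by rewrite divr_ge0// ltW.
rewrite /geo_const mulrACA -!powRM//.
apply: le_trans (powR_amgm p01 (mulr_ge0 lp x0) (mulr_ge0 kq y0)) _.
by rewrite (mulrA p) (mulrA (1 - p)) (mulrC p) (mulrC (1 - p)) !divfK ?gt_eqF.
Qed.

(** Equality in [geo_const_mean] holds when [p] and [1 - p] are proportional to
    [l * x] and [(1 - l) * y]; this is used for the [n]-th roots of [a] and [b].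
    No such [p] exists if [a] or [b] vanishes, which is what the first two bounds
    on [K] are for. If both are positive and one is infinite, the bound for
    [p = 1 / 2] already forces [K = +oo]. *)
Lemma optimal_exponent (n : nat) (l : R) (a b K : \bar R) : (0 < n)%N ->
  0 < l < 1 -> (0 <= a)%E -> (0 <= b)%E ->
  ((l ^+ n)%:E * a <= K)%E -> (((1 - l) ^+ n)%:E * b <= K)%E ->
  (forall p : R, (0 < p < 1)%R ->
    (geo_const l p ^+ n)%:E * (a `^ p * b `^ (1 - p)) <= K)%E ->
  (l%:E * a `^ n%:R^-1 + (1 - l)%:E * b `^ n%:R^-1 <= K `^ n%:R^-1)%E.
Proof.
move=> n0 /[dup] l01 /andP[l0 l1] a0 b0 aK bK pK.
have k0 : 0 < 1 - l by rewrite subr_gt0.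
have nr0 : (n%:R : R) != 0 by rewrite pnatr_eq0 -lt0n.
have ni0 : (n%:R^-1 : R) != 0 by rewrite invr_eq0.
have root (u : R) : 0 <= u -> (u ^+ n) `^ n%:R^-1 = u.
  by move=> u0; rewrite -powR_mulrn// -powRrM divff// powRr1.
have pow (u : R) : 0 <= u -> (u `^ n%:R^-1) ^+ n = u.
  by move=> u0; rewrite -powR_mulrn ?powR_ge0// -powRrM mulVf// powRr1.
have K0 : (0 <= K)%E.
  by apply: le_trans aK; rewrite mule_ge0// lee_fin exprn_ge0// ltW.
have rootE (u : R) (v : \bar R) : 0 <= u -> (0 <= v)%E ->
    ((u ^+ n)%:E * v <= K)%E -> (u%:E * v `^ n%:R^-1 <= K `^ n%:R^-1)%E.
  move=> u0 v0 uvK.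
  have uv0 : (0 <= (u ^+ n)%:E * v)%E by rewrite mule_ge0// lee_fin exprn_ge0.
  have in0 : 0 <= (n%:R^-1 : R) by rewrite invr_ge0.
  have := le_poweR in0 uv0 uvK.
  by rewrite poweRM ?lee_fin ?exprn_ge0// poweR_EFin root.
have [az|aN0] := eqVneq a 0%E.
  by rewrite az poweR0r// mule0 add0e rootE// ltW.
have [bz|bN0] := eqVneq b 0%E.
  by rewrite [X in (_ + _ * X)%E](_ : _ = 0%E) ?mule0 ?adde0 ?rootE// ?(ltW l0)// bz poweR0r.
have ap : (0 < a)%E by rewrite lt_neqAle eq_sym aN0.
have bp : (0 < b)%E by rewrite lt_neqAle eq_sym bN0.
have Koo : (a = +oo%E \/ b = +oo%E) -> (K = +oo)%E.
  move=> ab; have h01 : 0 < (2^-1 : R) < 1 by apply/andP; split; lra.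
  have := pK _ h01; rewrite (_ : _ * _ = +oo)%E ?leye_eq; first by move/eqP.
  have c0 : (0 < (geo_const l 2^-1 ^+ n)%:E)%E.
    by rewrite lte_fin exprn_gt0// geo_const_gt0.
  have h1 : (2^-1 : R) != 0 by rewrite invr_eq0.
  have h2 : (1 - 2^-1 : R) != 0 by rewrite gt_eqF// subr_gt0; case/andP: h01.
  case: ab => ->.
    by rewrite poweRyr// gt0_mulye ?poweR_gt0// gt0_muley.
  by rewrite [X in (_ * (_ * X))%E]poweRyr// gt0_muley ?poweR_gt0// gt0_muley.
have [ab|nab] := pselect (a = +oo \/ b = +oo)%E.
  by rewrite (Koo ab) poweRyr// leey.
have afin : a \is a fin_num.
  by rewrite ge0_fin_numE// ltey; apply/eqP => aoo; apply: nab; left.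
have bfin : b \is a fin_num.
  by rewrite ge0_fin_numE// ltey; apply/eqP => boo; apply: nab; right.
move: a b afin bfin pK ap bp {a0 b0 aK bK aN0 bN0 Koo nab}.
move=> [a||]// [b||]// _ _ pK; rewrite !lte_fin => a0 b0.
pose u := a `^ n%:R^-1; pose v := b `^ n%:R^-1.
have u0 : 0 < u by rewrite powR_gt0.
have v0 : 0 < v by rewrite powR_gt0.
have un : u ^+ n = a by rewrite pow// ltW.
have vn : v ^+ n = b by rewrite pow// ltW.
pose S := l * u + (1 - l) * v.
have lu0 : 0 < l * u by rewrite mulr_gt0.
have kv0 : 0 < (1 - l) * v by rewrite mulr_gt0.
have S0 : 0 < S by rewrite addr_gt0.
pose p := l * u / S.
have qE : 1 - p = (1 - l) * v / S.
  by rewrite /p /S; field; rewrite gt_eqF.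
have p01 : 0 < p < 1.
  by rewrite divr_gt0//= ltr_pdivrMr// mul1r /S ltrDl.
have cE : geo_const l p * (u `^ p * v `^ (1 - p)) = S.
  have lpE : l / p * u = S by rewrite /p; field; rewrite !gt_eqF.
  have kqE : (1 - l) / (1 - p) * v = S.
    by rewrite qE; field; rewrite !gt_eqF.
  have lp0 : 0 <= l / p by rewrite ltW// divr_gt0//; case/andP: p01.
  have kq0 : 0 <= (1 - l) / (1 - p).
    by rewrite ltW// divr_gt0// subr_gt0; case/andP: p01.
  rewrite /geo_const mulrACA -!powRM ?(ltW u0) ?(ltW v0)//.
  by rewrite lpE kqE powR_geo// ltW.
have powX (w r : R) : 0 <= w -> (w ^+ n) `^ r = (w `^ r) ^+ n.
  move=> w0; rewrite -powR_mulrn// -powRrM mulrC powRrM powR_mulrn//.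
  exact: powR_ge0.
have SK : ((S ^+ n)%:E <= K)%E.
  have := pK p p01; rewrite !poweR_EFin -!EFinM -un -vn.
  by rewrite !powX ?(ltW u0) ?(ltW v0)// -!exprMn cE.
have := rootE S 1%E (ltW S0) (@lee01 R).
by rewrite poweR1r !mule1 => /(_ SK); apply: le_trans.
Qed.

End optimal_exponent.

(** * The inequality *)

Theorem theorem4 (R : realType) (n : nat) (hn : (1 <= n)%N)
    (mu : {measure set (lebesgueRn R n) -> \bar R})
    (hmu : unconditional_log_concave mu)
    (A B : set 'rV[R]_n) (A0 : A !=set0) (B0 : B !=set0)
    (hA : ideal A) (hB : ideal B)
    (lambda : R) (hlambda : 0 <= lambda <= 1) :
  (lambda%:E * (mu A `^ n%:R^-1) + (1 - lambda)%:E * (mu B `^ n%:R^-1)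
   <= mu [set (lambda *: a + (1 - lambda) *: b)%R | a in A & b in B]
        `^ n%:R^-1)%E.
Proof.
set C := [set _ | _ in A & _ in B].
have [e|l0N] := eqVneq lambda 0.
  rewrite /C e mul0e add0e subr0 mul1e (_ : [set _ | _ in A & _ in B] = B)//.
  apply/seteqP; split => [_ [a Aa] [b Bb] <-|b Bb].
    by rewrite scale0r add0r scale1r.
  have [a Aa] := A0; exists a => //; exists b => //.
  by rewrite scale0r add0r scale1r.
have [e|l1N] := eqVneq lambda 1.
  rewrite /C e subrr mul0e adde0 mul1e (_ : [set _ | _ in A & _ in B] = A)//.
  apply/seteqP; split => [_ [a Aa] [b Bb] <-|a Aa].
    by rewrite scale0r addr0 scale1r.
  have [b Bb] := B0; exists a => //; exists b => //.
  by rewrite scale0r addr0 scale1r.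
have l01 : 0 < lambda < 1.
  by case/andP: hlambda => l0 l1; rewrite !lt_neqAle eq_sym l0N l0 l1N l1.
have /andP[l0 l1] := l01; have k0 : 0 < 1 - lambda by rewrite subr_gt0.
have hC : ideal C.
  move=> _ delta [a Aa [b Bb <-]] hd.
  exists (\row_i (delta i * a ord0 i)); first exact: hA.
  exists (\row_i (delta i * b ord0 i)); first exact: hB.
  by apply/rowP => i; rewrite !mxE; ring.
have sA := ideal_solid hA; have sB := ideal_solid hB; have sC := ideal_solid hC.
have zeroP (X : set 'rV[R]_n) : X !=set0 -> solid_set X -> X 0.
  by move=> [x Xx] sX; apply: sX Xx => i; rewrite mxE normr0.
have zA := zeroP _ A0 sA; have zB := zeroP _ B0 sB.
case: hmu => U [Uconv Uunc muE].
have Usolid := convex_unconditional_solid Uconv Uunc.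
pose phi (x : 'rV[R]_n) : \bar R := expeR (- U x)%E.
have phi_solid x y : dominated y x -> (phi x <= phi y)%E.
  by move=> yx; rewrite lee_expeR leeN2 Usolid.
have phi0 x : (0 <= phi x)%E by exact: expeR_ge0.
have muI (X : set 'rV[R]_n) : solid_set X ->
    mu X = (\int[lebesgue_measureRn]_x (phi \_ X) x)%E.
  move=> sX; rewrite muE; first exact: integral_mkcond.
  exact: solid_set_measurable.
have rsolid X : solid_set X -> solid_fun (phi \_ X).
  move=> sX x y yx; rewrite !patchE; case: ifPn => [|_]; last by case: ifP.
  by rewrite inE => Xx; rewrite mem_set ?phi_solid//; exact: sX Xx.
have r0 X x : (0 <= (phi \_ X) x)%E by apply: erestrict_ge0.
have rin X x : X x -> (phi \_ X) x = phi x by move=> Xx; rewrite patchE mem_set.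
have rout X x : ~ X x -> (phi \_ X) x = 0%E by move=> Xx; rewrite patchE memNset.
have dil (X : set 'rV[R]_n) (c : R) : 0 < c < 1 -> solid_set X ->
    (forall x, X x -> C (c *: x)) -> ((c ^+ n)%:E * mu X <= mu C)%E.
  move=> /andP[c0 c1] sX XC; rewrite (muI X)// (muI C)//.
  apply: solid_integral_dilation => //; [exact: rsolid|exact: rsolid|].
  move=> x; have [Xx|nXx] := pselect (X x); last by rewrite (rout X).
  rewrite rin// rin; last exact: XC.
  apply: phi_solid => i; rewrite mxE normrM gtr0_norm//.
  by rewrite ler_piMl// ltW.
apply: optimal_exponent => //.
- apply: dil => // x Ax; exists x => //; exists 0 => //.
  by rewrite scaler0 addr0.
- apply: dil => //; first by rewrite k0 ltrBlDr ltrDl.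
  by move=> x Bx; exists 0 => //; exists x => //; rewrite scaler0 add0r.
move=> p p01; have /andP[p0 p1] := p01.
rewrite (muI A)// (muI B)// (muI C)//.
have c0 := geo_const_gt0 l01 p01.
apply: solid_prekopa_leindler => //; [exact: rsolid..|].
move=> x y z xyz.
have q0 : 0 < 1 - p by rewrite subr_gt0.
have [Ax|nAx] := pselect (A x); last first.
  by rewrite (rout A)// poweR0r ?gt_eqF// mul0e.
have [By|nBy] := pselect (B y); last first.
  by rewrite (rout B)// [X in (_ * X)%E]poweR0r ?gt_eqF// mule0.
pose absr (w : 'rV[R]_n) : 'rV[R]_n := \row_i `|w ord0 i|.
have absP (w : 'rV[R]_n) : dominated (absr w) w.
  by move=> i; rewrite mxE normr_id.
(* The scaled geometric mean is below the arithmetic mean with weight lambda, so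
   it stays in C; since the constant is at most 1, it is also below the one with
   weight p, which is the one to which the convexity of U applies. *)
have domC : dominated (geo_const lambda p *: z)
    (lambda *: absr x + (1 - lambda) *: absr y).
  move=> i; rewrite !mxE normrM xyz (gtr0_norm c0) [leRHS]ger0_norm.
    exact: geo_const_mean.
  by rewrite addr_ge0// mulr_ge0// ltW.
have domU : dominated (geo_const lambda p *: z)
    (p *: absr x + (1 - p) *: absr y).
  move=> i; rewrite !mxE normrM xyz (gtr0_norm c0) [leRHS]ger0_norm; last first.
    by rewrite addr_ge0// mulr_ge0// ltW.
  apply: le_trans (powR_amgm p01 (normr_ge0 _) (normr_ge0 _)).
  by rewrite ler_piMl ?geo_const_le1// mulr_ge0// powR_ge0.
have Cz : C (geo_const lambda p *: z).
  apply: sC domC _; exists (absr x); first exact: sA Ax.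
  by exists (absr y) => //; exact: sB By.
rewrite !rin//.
apply: le_trans (phi_solid _ _ domU).
apply: le_trans (convex_geo_mean _ _ Uconv p01).
by apply: lee_poweR_geo => //; exact: phi_solid.
Qed.
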